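(* Let $\mathcal H$ be a real Hilbert space, let $\Phi:\mathcal H\to\mathbb{R}\cup\{+\infty\}$ be a convex lower semicontinuous proper function, and let $B:\mathcal H\to\mathcal H$ be a monotone $\beta$-cocoercive operator for some $\beta>0$. Suppose that $S=\{z\in\mathcal H:\ \partial\Phi(z)+Bz\ni0\}$ is nonempty. Then, for any orbit $x:[0,+\infty[\,\to\mathcal H$ of the differential inclusion $$\dot x(t)+\partial\Phi(x(t))+B(x(t))\ni0,$$ the following properties hold: 1. $\int_0^{+\infty}\|\dot x(t)\|^2\,dt<+\infty$, i.e. $x(\cdot)$ has a finite energy; 2. $x(t)$ converges weakly to an element of $S$ as $t\to+\infty$; 3. $B(x(t))$ converges strongly to $Bz$ as $t\to+\infty$, where $Bz$ is uniquely defined for $z\in S$ (i.e. it is the same vector for all $z\in S$).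
   Context: $\partial\Phi$ is the convex subdifferential and $\mathrm{dom}\,\Phi=\{x:\Phi(x)<+\infty\}$. $B:\mathcal H\to\mathcal H$ is $\beta$-cocoercive if $\langle Bx-By,x-y\rangle\ge\beta\|Bx-By\|^2$ for all $x,y\in\mathcal H$. The operator $A=\partial\Phi+B$ is maximal monotone; the orbits are the solution trajectories of the differential inclusion, i.e. those of the semigroup of contractions generated by $-A$. For any $x_0\in\mathrm{dom}\,\partial\Phi$ there is a unique strong solution with $x(0)=x_0$; moreover (regularizing effect) for any $x_0\in\overline{\mathrm{dom}\,\Phi}$ there is a unique strong solution with $x(0)=x_0$, and it satisfies $x(t)\in\mathrm{dom}\,\partial\Phi$ for all $t>0$. Here a strong solution is a continuous $x:[0,+\infty[\,\to\mathcal H$, absolutely continuous on each compact subinterval of $]0,+\infty[$, satisfying the inclusion for almost every $t>0$.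
   Formalization: Item 1 fails for orbits with x(0) in the closure of dom Φ but not in dom Φ (e.g. Φ(u)=u+1/u for u>0, B=0, x(0)=0), so finite energy on ]0,+∞[ is claimed only when x(0) ∈ dom Φ, and on ]a,+∞[ for every a>0 for all orbits. *)

(* Defs.v *)
From HB Require Import structures.
From mathcomp Require Import all_boot all_order all_algebra.
From mathcomp Require Import all_classical all_reals all_analysis.

Set Implicit Arguments.
Unset Strict Implicit.
Unset Printing Implicit Defensive.

Import Order.TTheory GRing.Theory Num.Theory.
Import numFieldNormedType.Exports.

Local Open Scope classical_set_scope.
Local Open Scope ring_scope.

(* A real Hilbert space is a complete normed module [H] over [R : realType]
   together with a dot product [dot] (a symmetric positive definite bilinear
   form) that induces the norm of [H]. *)
Definition induces_norm (R : realType) (H : completeNormedModType R)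
    (dot : {dot H for @idfun R}) : Prop :=
  forall u : H, `|u| ^+ 2 = dot u u.

(* The extended real line [\bar R] contains -oo, which is not an allowed value
   of a function with values in R U {+oo}. *)
Definition proper_function (R : realType) (H : completeNormedModType R)
    (Phi : H -> \bar R) : Prop :=
  (forall u : H, -oo < Phi u)%E /\ exists u : H, (Phi u < +oo)%E.

(* In [\bar R], 0 * +oo = 0, so the cases t = 0 and t = 1 are harmless. *)
Definition convex_efunction (R : realType) (H : completeNormedModType R)
    (Phi : H -> \bar R) : Prop :=
  forall (u v : H) (t : R), 0 <= t <= 1 ->
    (Phi (t *: u + (1 - t) *: v)%R <= t%:E * Phi u + (1 - t)%:E * Phi v)%E.

Definition effective_domain (R : realType) (H : completeNormedModType R)
    (Phi : H -> \bar R) : set H :=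
  [set u | (Phi u < +oo)%E].

(* For proper [Phi] this set is empty when [Phi u = +oo]. *)
Definition subdifferential (R : realType) (H : completeNormedModType R)
    (dot : {dot H for @idfun R}) (Phi : H -> \bar R) (u : H) : set H :=
  [set p | forall v : H, (Phi u + (dot p (v - u)%R)%:E <= Phi v)%E].

Definition monotone_operator (R : realType) (H : completeNormedModType R)
    (dot : {dot H for @idfun R}) (B : H -> H) : Prop :=
  forall u v : H, 0 <= dot (B u - B v) (u - v).

Definition cocoercive (R : realType) (H : completeNormedModType R)
    (dot : {dot H for @idfun R}) (beta : R) (B : H -> H) : Prop :=
  forall u v : H, beta * `|B u - B v| ^+ 2 <= dot (B u - B v) (u - v).

Definition zeros (R : realType) (H : completeNormedModType R)
    (dot : {dot H for @idfun R}) (Phi : H -> \bar R) (B : H -> H) : set H :=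
  [set z | [set p + B z | p in subdifferential dot Phi z] 0].

Definition abs_continuous_on (R : realType) (H : completeNormedModType R)
    (a b : R) (x : R -> H) : Prop :=
  forall e : R, 0 < e -> exists2 d : R, 0 < d &
    forall (n : nat) (s t : 'I_n -> R),
      (forall i, [/\ a <= s i, s i <= t i & t i <= b]) ->
      trivIset [set: 'I_n] (fun i => `]s i, t i[%classic) ->
      \sum_(i < n) (t i - s i) < d ->
      \sum_(i < n) `|x (t i) - x (s i)| < e.

(* An orbit [0, +oo[ -> H is represented by a function on [R], whose values at
   negative times are irrelevant. The two-sided derivative is only used at
   times t > 0; for a.e. such t it is required to exist. *)
Definition strong_solution (R : realType) (H : completeNormedModType R)
    (dot : {dot H for @idfun R}) (Phi : H -> \bar R) (B : H -> H)
    (x : R -> H) : Prop :=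
  [/\ {within `[0, +oo[%classic, continuous x},
      (forall a b : R, 0 < a -> a <= b -> abs_continuous_on a b x) &
      {ae @lebesgue_measure R, forall t : R, 0 < t ->
         derivable x t 1 /\
         [set derive1 x t + p + B (x t) | p in subdifferential dot Phi (x t)] 0}].

(* The integral of |x'(t)|^2 over ]a, +oo[ is finite. *)
Definition finite_energy (R : realType) (H : completeNormedModType R)
    (a : R) (x : R -> H) : Prop :=
  (@lebesgue_measure R).-integrable `]a, +oo[%classic
    (fun t : R => (`|derive1 x t| ^+ 2)%:E).

Definition weakly_cvg_pinfty (R : realType) (H : completeNormedModType R)
    (dot : {dot H for @idfun R}) (x : R -> H) (z : H) : Prop :=
  forall y : H, dot (x t) y @[t --> +oo] --> dot z y.

(* Main.v *)
(* Put e(t) = B(x(t)) - Bz with z in S. Cocoercivity gives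
     d/dt |x - z|^2 <= - 2 beta |e|^2,
   and the energy
     E(t) = Phi(x(t)) - Phi(z) + <Bz, x(t) - z> + |x(t) - z|^2 / (4 beta) >= 0
   satisfies dE/dt <= - |x'|^2 / 2; integrating yields the finite energy. Two
   orbits issued from x contract, so |x'| is nonincreasing along the orbit; hence
   x is Lipschitz away from 0, and the two inequalities force e(t) -> 0 and
   x'(t) -> 0. Thus - x' - Bx, a subgradient of Phi at x(t), tends strongly to
   - Bz, every weak cluster point of x is in S, and Opial's argument concludes.

   All differential inequalities are integrated with one-sided slopes: the
   subgradient inequality at x(t) bounds Phi(x(t)) - Phi(x(s)) from above, which
   controls difference quotients only for s < t, but this is enough for an
   absolutely continuous function, and no chain rule for Phi o x is needed. Weak
   compactness of balls is replaced by limits along ultrafilters. *)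
Require Import Defs.
From HB Require Import structures.
From mathcomp Require Import all_boot all_order all_algebra.
From mathcomp Require Import all_classical all_reals all_analysis.
From mathcomp Require Import measurable_realfun.
From mathcomp Require Import ring lra.

Set Implicit Arguments.
Unset Strict Implicit.
Unset Printing Implicit Defensive.

Import Order.TTheory GRing.Theory Num.Theory.
Import numFieldNormedType.Exports.

Local Open Scope classical_set_scope.
Local Open Scope ring_scope.

(** * Hilbert spaces *)

Section dot_theory.
Context {R : realType} {H : completeNormedModType R} (dot : {dot H for @idfun R}).

(** The obstacle is that the inclusion holds only at almost every time: elsewhere no subgradient at
    x(t) is at hand, and even Phi(x(t)) < +oo has to be proved. On each [a, +oo[ with a > 0 the
    available subgradients are bounded and their times are dense; lower semicontinuity then makes
    Phi o x Lipschitz with respect to x, so that E is absolutely continuous there.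

    Both limits e -> 0 and x' -> 0 come from a nonincreasing function bounded below. Where |e| is
    large it stays so for a fixed time ahead, x being Lipschitz, and |x - z|^2 drops by a fixed
    amount; where |x'| is large it was at least as large during the unit of time before, and E
    drops.

    At t = 0 the orbit is merely continuous and E may be unbounded, so integrability up to 0 needs
    an upper bound on E, which exists when Phi(x(0)) is finite. *)

Lemma dotC (u v : H) : dot u v = dot v u.
Proof. by rewrite hermC /= expr0 mul1r. Qed.

Lemma dotBl (u v w : H) : dot (u - v) w = dot u w - dot v w.
Proof. exact: linearBl. Qed.

Lemma dotDl (u v w : H) : dot (u + v) w = dot u w + dot v w.
Proof. exact: linearDl. Qed.

Lemma dotNl (u w : H) : dot (- u) w = - dot u w.
Proof. exact: linearNl. Qed.

Lemma dotZl (k : R) (u w : H) : dot (k *: u) w = k * dot u w.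
Proof. exact: linearZl_LR. Qed.

Lemma dot0l (w : H) : dot 0 w = 0.
Proof. exact: linear0l. Qed.

Lemma dotBr (u v w : H) : dot w (u - v) = dot w u - dot w v.
Proof. by rewrite !(dotC w) dotBl. Qed.

Lemma dotDr (u v w : H) : dot w (u + v) = dot w u + dot w v.
Proof. by rewrite !(dotC w) dotDl. Qed.

Lemma dotNr (u w : H) : dot w (- u) = - dot w u.
Proof. by rewrite !(dotC w) dotNl. Qed.

Lemma dotZr (k : R) (u w : H) : dot w (k *: u) = k * dot w u.
Proof. by rewrite !(dotC w) dotZl. Qed.

Lemma dot0r (w : H) : dot w 0 = 0.
Proof. by rewrite dotC dot0l. Qed.

Definition dotE := (dotBl, dotDl, dotNl, dotZl, dotBr, dotDr, dotNr, dotZr).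

Context (dot_norm : induces_norm dot).

Lemma dot_ge0 (u : H) : 0 <= dot u u.
Proof. by rewrite -dot_norm sqr_ge0. Qed.

(** Cauchy-Schwarz, from the nonnegativity of the squared norm of |v| u - |u| v. *)
Lemma dot_le_norm (u v : H) : dot u v <= `|u| * `|v|.
Proof.
have [->|u0] := eqVneq u 0; first by rewrite dot0l normr0 mul0r.
have [->|v0] := eqVneq v 0; first by rewrite dot0r normr0 mulr0.
have nu : 0 < `|u| by rewrite normr_gt0.
have nv : 0 < `|v| by rewrite normr_gt0.
have := dot_ge0 (`|v| *: u - `|u| *: v).
rewrite !dotE (dotC v u) -!dot_norm => h.
have : 0 <= 2 * (`|u| * `|v|) * (`|u| * `|v| - dot u v) by lra.
by rewrite pmulr_rge0 ?mulr_gt0// subr_ge0.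
Qed.

Lemma norm_dot_le (u v : H) : `|dot u v| <= `|u| * `|v|.
Proof.
by rewrite ler_norml dot_le_norm andbT lerNl -dotNl -(normrN u) dot_le_norm.
Qed.

Lemma sqr_normB (u v : H) : `|u - v| ^+ 2 = `|u| ^+ 2 - 2 * dot u v + `|v| ^+ 2.
Proof. by rewrite !dot_norm !dotE (dotC v u); ring. Qed.

Lemma sqr_normD (u v : H) : `|u + v| ^+ 2 = `|u| ^+ 2 + 2 * dot u v + `|v| ^+ 2.
Proof. by rewrite !dot_norm !dotE (dotC v u); ring. Qed.

End dot_theory.

(** * Projections, Riesz representation and weak limits *)

Section hilbert.
Context {R : realType} {H : completeNormedModType R} (dot : {dot H for @idfun R}).
Context (dot_norm : induces_norm dot).

Definition convex_subset (C : set H) : Prop :=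
  forall (u v : H) (t : R), 0 <= t <= 1 -> C u -> C v -> C (t *: u + (1 - t) *: v).

(** Common source of the projection and of Riesz representation. The midpoint inequality bounds |u -
    v|^2 / 4 by the mean excess of J over its infimum, so the filter generated by the sets of
    e-minimizers is Cauchy. *)
Lemma strongly_convex_minimizer (C : set H) (J : H -> R) (m : R) :
  C !=set0 -> closed C -> convex_subset C -> continuous J ->
  (forall u, C u -> m <= J u) ->
  (forall u v, C u -> C v ->
     J (2^-1 *: u + (1 - 2^-1) *: v) <= (J u + J v) / 2 - `|u - v| ^+ 2 / 4) ->
  exists2 c, C c & forall v, C v -> J c <= J v.
Proof.
move=> [c0 Cc0] clC cvC cJ Jm Jmid.
pose E := J @` C.
have lE : has_lbound E by exists m => _ [u Cu <-]; exact: Jm.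
have iE : has_inf E by split => //; exists (J c0); exists c0.
pose A (e : R) := [set u | C u /\ J u < inf E + e].
pose F := filter_from [set e : R | 0 < e] A.
have FF : ProperFilter F.
  apply: filter_from_proper.
    apply: filter_from_filter; first by exists 1 => /=.
    move=> e1 e2 /= e10 e20; exists (Num.min e1 e2); first by rewrite /= lt_min e10.
    move=> u [Cu Ju]; have h1 : Num.min e1 e2 <= e1 by rewrite ge_min lexx.
    have h2 : Num.min e1 e2 <= e2 by rewrite ge_min lexx orbT.
    by split; split=> //=; lra.
  move=> e e0; have [_ [u Cu <-] Ju] := inf_adherent e0 iE.
  by exists u; split.
have Fe e : 0 < e -> F (A e) by move=> e0; exists e.
have cF : cauchy F.
  apply: cauchy_exP => e e0.
  (* Two points exceeding the infimum by less than e^2 / 4 lie at distance less than e. *)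
  pose d := e ^+ 2 / 4.
  have d0 : 0 < d by rewrite divr_gt0// exprn_gt0.
  have [y [Cy Jy]] := filter_ex (Fe d d0).
  exists y; apply: filterS (Fe d d0) => u [Cu Ju].
  rewrite -ball_normE /= -(@ltr_pXn2r _ 2)// ?nnegrE ?(ltW e0)//.
  have := Jmid y u Cy Cu.
  have : inf E <= J (2^-1 *: y + (1 - 2^-1) *: u).
    apply: ge_inf => //; exists (2^-1 *: y + (1 - 2^-1) *: u) => //.
    by apply: cvC => //; lra.
  rewrite /d in Jy Ju; lra.
have /cvg_ex[c Fc] : cvg F by exact: cauchy_cvg.
have near_c P : nbhs c P -> forall e, 0 < e -> exists u, A e u /\ P u.
  move=> cP e e0; have := filter_ex (filterI (Fe e e0) (Fc _ cP)).
  by move=> [u [? ?]]; exists u.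
exists c.
  apply: clC => P /near_c/(_ 1 ltr01)[u [[Cu _] Pu]]; by exists u.
move=> v Cv; apply: (@le_trans _ _ (inf E)); last by apply: ge_inf => //; exists v.
apply/ler_addgt0Pr => e e0; have e2 : 0 < e / 2 by lra.
have : nbhs c [set u | `|J c - J u| < e / 2].
  by have /cvgr_dist_lt := cJ c; exact.
move=> /near_c/(_ _ e2)[u [[Cu Ju] /= Jcu]].
have := le_lt_trans (ler_norm _) Jcu; lra.
Qed.

Lemma sqr_dist_continuous (u : H) : continuous (fun v : H => `|v - u| ^+ 2).
Proof.
move=> v; rewrite /continuous_at expr2.
under eq_fun do rewrite expr2.
have h : (fun v => `|v - u|) @ v --> `|v - u|.
  by apply: cvg_norm; apply: cvgB; [exact: cvg_id|exact: cvg_cst].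
exact: cvgM.
Qed.

Lemma midpoint_identity (u v : H) : `|2^-1 *: u + (1 - 2^-1) *: v| ^+ 2 =
  (`|u| ^+ 2 + `|v| ^+ 2) / 2 - `|u - v| ^+ 2 / 4.
Proof.
rewrite !dot_norm !(dotBl, dotDl, dotBr, dotDr, dotZl, dotZr) (dotC _ v u).
by field.
Qed.

Lemma first_variation_ge0 (a b : R) :
  (forall s, 0 < s -> s <= 1 -> 0 <= 2 * s * a + s ^+ 2 * b) -> 0 <= a.
Proof.
move=> h; rewrite leNgt; apply/negP => a0.
(* If a < 0, this s gives s b <= - a, and then 2 s a + s^2 b <= s a < 0. *)
pose s := Num.min 1 (- a / (`|b| + 1)).
have b1 : 0 < `|b| + 1 by rewrite ltr_wpDl.
have s0 : 0 < s by rewrite lt_min ltr01 divr_gt0// oppr_gt0.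
have s1 : s <= 1 by rewrite ge_min lexx.
have sa : s * (`|b| + 1) <= - a.
  by rewrite -ler_pdivlMr// ge_min lexx orbT.
have := h s s0 s1; have := ler_norm b => hb.
have : s * b <= - a by apply: le_trans sa; rewrite ler_pM2l//; lra.
nra.
Qed.

(** p minimizes |v - z|^2 over C; the inequality is the first variation of this function along the
    segment from p to v. *)
Lemma projection (C : set H) (z : H) : C !=set0 -> closed C -> convex_subset C ->
  exists2 p, C p & forall v, C v -> dot (z - p) (v - p) <= 0.
Proof.
move=> C0 clC cvC.
have dist_mid u v : C u -> C v -> `|2^-1 *: u + (1 - 2^-1) *: v - z| ^+ 2 <=
    (`|u - z| ^+ 2 + `|v - z| ^+ 2) / 2 - `|u - v| ^+ 2 / 4.
  move=> _ _; have -> : 2^-1 *: u + (1 - 2^-1) *: v - z =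
      2^-1 *: (u - z) + (1 - 2^-1) *: (v - z).
    rewrite !scalerBr addrACA -opprD -scalerDl.
    by rewrite (_ : 2^-1 + (1 - 2^-1) = 1 :> R) ?scale1r//; field.
  by rewrite midpoint_identity opprB addrA subrK.
have [p Cp pmin] := strongly_convex_minimizer C0 clC cvC (@sqr_dist_continuous z)
  (fun u _ => sqr_ge0 `|u - z|) dist_mid.
exists p => // v Cv; rewrite -oppr_ge0 -dotNl opprB.
apply: (@first_variation_ge0 _ (`|v - p| ^+ 2)) => s s0 s1.
have s01 : 0 <= s <= 1 by rewrite ltW.
have := pmin _ (cvC v p s s01 Cv Cp).
have -> : s *: v + (1 - s) *: p - z = (p - z) + s *: (v - p).
  by rewrite scalerBl scale1r scalerBr addrCA addrAC.
rewrite (sqr_normD dot_norm (p - z)) dotZr normrZ exprMn ger0_norm ?(ltW s0)//.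
lra.
Qed.

(* The representing vector minimizes |u|^2 - 2 l(u). *)
Lemma riesz (l : H -> R) (M : R) : {morph l : u v / u + v} ->
  (forall k u, l (k *: u) = k * l u) -> (forall u, `|l u| <= M * `|u|) ->
  exists w, forall y, l y = dot w y.
Proof.
move=> lD lZ lM.
have lN u : l (- u) = - l u by rewrite -scaleN1r lZ mulN1r.
pose J u := `|u| ^+ 2 - 2 * l u.
have cl : continuous l.
  move=> u; apply/cvgrPdist_lt => e e0.
  have M1 : 0 < `|M| + 1 by rewrite ltr_wpDl.
  have e' : 0 < e / (`|M| + 1) by rewrite divr_gt0.
  near=> v; rewrite -lN -lD (le_lt_trans (lM _))//.
  have : `|u - v| < e / (`|M| + 1).
    by near: v; have /cvgr_dist_lt := @cvg_id _ (nbhs u); exact.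
  rewrite ltr_pdivlMr// => h; apply: le_lt_trans h; rewrite mulrC ler_wpM2l//.
  by rewrite (le_trans (ler_norm _))// lerDl.
have cJ : continuous J.
  move=> u; apply: cvgB; last by apply: cvgM; [exact: cvg_cst|exact: cl].
  have := @sqr_dist_continuous 0 u; rewrite /continuous_at subr0.
  by under eq_fun do rewrite subr0.
have J_ge u : [set: H] u -> - M ^+ 2 <= J u.
  move=> _; have := sqr_ge0 (`|u| - M); have := lM u.
  by rewrite /J ler_norml => /andP[_]; lra.
have J_mid u v : [set: H] u -> [set: H] v ->
    J (2^-1 *: u + (1 - 2^-1) *: v) <= (J u + J v) / 2 - `|u - v| ^+ 2 / 4.
  by move=> _ _; rewrite /J midpoint_identity lD !lZ; lra.
have T0 : [set: H] !=set0 by exists 0.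
have cvT : convex_subset [set: H] by [].
have [w _ wmin] := strongly_convex_minimizer T0 closedT cvT cJ J_ge J_mid.
exists w => y.
suff half v : 0 <= dot w v - l v.
  by apply/eqP; rewrite eq_le; have := half y; have := half (- y);
     rewrite dotNr lN; lra.
apply: (@first_variation_ge0 _ (`|v| ^+ 2)) => s s0 s1.
have := wmin (w + s *: v) I; rewrite /J (sqr_normD dot_norm w) lD lZ dotZr normrZ.
by rewrite exprMn ger0_norm ?(ltW s0)//; lra.
Unshelve. all: by end_near. Qed.

(** Mazur's argument: the projection p of w satisfies <w - p, x(t) - p> <= 0 whenever x(t) is in C,
    and the weak limit turns this into |w - p|^2 <= 0. *)
Lemma weak_closed_convex (F : set_system R) (x : R -> H) (w : H) (C : set H) :
  ProperFilter F -> (forall y, dot (x t) y @[t --> F] --> dot w y) ->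
  closed C -> convex_subset C -> F [set t | C (x t)] -> C w.
Proof.
move=> FF xw clC cvC FC.
have C0 : C !=set0 by have [t Ct] := filter_ex FC; exists (x t).
have [p Cp pP] := projection w C0 clC cvC.
suff wp : dot (w - p) (w - p) <= 0.
  move: wp; rewrite -dot_norm => wp.
  have : `|w - p| ^+ 2 = 0 by apply/eqP; rewrite eq_le wp sqr_ge0.
  by move/eqP; rewrite sqrf_eq0 normr_eq0 subr_eq0 => /eqP ->.
have h : dot (x t - p) (w - p) @[t --> F] --> dot (w - p) (w - p).
  under eq_fun do rewrite dotBl.
  rewrite dotBl; apply: cvgB; [exact: xw|exact: cvg_cst].
apply: (cvgr_to_le h).
by apply: filterS FC => t Ct; rewrite dotC; exact: pP.
Qed.

Lemma ultra_bounded_cvg (U : set_system R) (f : R -> R) (M : R) : UltraFilter U ->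
  U [set t | `|f t| <= M] -> exists l : R, f t @[t --> U] --> l.
Proof.
move=> UU Uf.
have Usegment : U (f @^-1` `[- M, M]%classic).
  by apply: filterS Uf => t; rewrite /= ler_norml in_itv.
have [l [_ fl]] := segment_compact (fmap_proper_filter f _) Usegment.
exists l => V Vl; have [//|UnV] := in_ultra_setVsetC (f @^-1` V) UU.
have [y [nVy Vy]] := fl (~` V) V UnV Vl.
by case: nVy.
Qed.

(** Along an ultrafilter each bounded function <x(t), y> has a limit, which is linear in y and at
    most M |y| in absolute value, so Riesz representation yields w. *)
Lemma ultra_weak_limit (U : set_system R) (x : R -> H) (M : R) : UltraFilter U ->
  U [set t | `|x t| <= M] ->
  exists w, forall y, dot (x t) y @[t --> U] --> dot w y.
Proof.
move=> UU Ux.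
have /choice[l lP] y : exists l : R, dot (x t) y @[t --> U] --> l.
  apply: (@ultra_bounded_cvg _ _ (M * `|y|)) => //; apply: filterS Ux => t /= xM.
  by rewrite (le_trans (norm_dot_le dot_norm _ _))// ler_wpM2r.
suff [w wP] : exists w, forall y, l y = dot w y.
  by exists w => y; rewrite -wP; exact: lP.
apply: (@riesz _ M).
- move=> u v; apply: (cvg_unique _ (lP (u + v))) => //.
  rewrite /=; under eq_fun do rewrite dotDr; apply: cvgD; exact: lP.
- move=> k u; apply: (cvg_unique _ (lP (k *: u))) => //.
  rewrite /=; under eq_fun do rewrite dotZr; apply: cvgM; [exact: cvg_cst|exact: lP].
- move=> u; have := cvg_norm (lP u) => h.
  apply: (cvgr_to_le (h _)); apply: filterS Ux => t /= xM.
  by rewrite (le_trans (norm_dot_le dot_norm _ _))// ler_wpM2r.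
Qed.

(** If <x(t), y> failed to converge to <w, y>, an ultrafilter finer than +oo would contain the set
    of times where the two are at distance at least e. *)
Lemma weakly_cvg_ultra (x : R -> H) (w : H) :
  (forall U : set_system R, UltraFilter U -> pinfty_nbhs R `<=` U ->
     forall y, dot (x t) y @[t --> U] --> dot w y) ->
  weakly_cvg_pinfty dot x w.
Proof.
move=> h y; apply/cvgrPdist_lt => e e0; apply: contrapT => nF.
pose A := [set t | ~ (`|dot w y - dot (x t) y| < e)].
have GG : ProperFilter (within A (pinfty_nbhs R)).
  apply: Build_ProperFilter; rewrite /within /= => F0; apply: nF.
  by apply: filterS F0 => t /= /contrapT.
have [U [UU GU]] := ultraFilterLemma GG.
have FU : pinfty_nbhs R `<=` U.
  by move=> P FP; apply: GU; apply: filterS FP => t Pt _.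
have UA : U A by apply: GU; apply: nearW.
have /cvgr_dist_lt/(_ e e0) UB := h U UU FU y.
by have [t [At Bt]] := filter_ex (filterI UA UB).
Qed.

(** If v and w are limits along two ultrafilters, |x - v|^2 - |x - w|^2 converges, hence so does <x,
    w - v>; its limit is both <v, w - v> and <w, w - v>, so v = w. *)
Lemma opial (x : R -> H) (S : set H) (M : R) :
  (forall t, 0 <= t -> `|x t| <= M) ->
  (forall z, S z -> exists l : R, `|x t - z| ^+ 2 @[t --> +oo] --> l) ->
  (forall (F : set_system R) w, ProperFilter F -> pinfty_nbhs R `<=` F ->
     (forall y, dot (x t) y @[t --> F] --> dot w y) -> S w) ->
  exists2 z, S z & weakly_cvg_pinfty dot x z.
Proof.
move=> xM dist_cvg cluster_S.
have weak_limit U : UltraFilter U -> pinfty_nbhs R `<=` U ->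
    exists w, forall y, dot (x t) y @[t --> U] --> dot w y.
  move=> UU oU; apply: (ultra_weak_limit (M := M)); apply: oU.
  have := @nbhs_pinfty_ge R 0 (num_real 0); apply: filterS => t; exact: xM.
have [U [UU oU]] := ultraFilterLemma (@proper_pinfty_nbhs R).
have [w wP] := weak_limit U UU oU.
have Sw : S w by exact: (cluster_S U w _ oU wP).
exists w => //; apply: weakly_cvg_ultra => V VV oV.
have [v vP] := weak_limit V VV oV.
have Sv : S v by exact: (cluster_S V v _ oV vP).
suff <- : v = w by [].
have [lw lwP] := dist_cvg w Sw; have [lv lvP] := dist_cvg v Sv.
pose l := (lv - lw + (`|w| ^+ 2 - `|v| ^+ 2)) / 2.
have cl : dot (x t) (w - v) @[t --> +oo] --> l.
  have -> : (fun t => dot (x t) (w - v)) = (fun t => (`|x t - v| ^+ 2 -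
      `|x t - w| ^+ 2 + (`|w| ^+ 2 - `|v| ^+ 2)) / 2).
    by apply/funext => t; rewrite !(sqr_normB dot_norm) dotBr; lra.
  apply: cvgM; last exact: cvg_cst.
  by apply: cvgD; [exact: cvgB|exact: cvg_cst].
have lwE : dot w (w - v) = l.
  apply: (cvg_unique _ (wP (w - v))) => //; move=> A /cl; exact: oU.
have lvE : dot v (w - v) = l.
  apply: (cvg_unique _ (vP (w - v))) => //; move=> A /cl; exact: oV.
apply/eqP; rewrite eq_sym -subr_eq0 -normr_eq0 -sqrf_eq0 dot_norm dotBl.
by rewrite lwE lvE subrr.
Qed.

End hilbert.

(** * One-sided slopes of absolutely continuous functions *)

(** The upper left Dini derivative of f at t is at most m, stated without division. *)
Definition left_slope_le (R : realType) (f : R -> R) (t m : R) : Prop :=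
  forall e : R, 0 < e -> \forall s \near t^'-, f t - f s <= (m + e) * (t - s).

Section left_slope.
Context {R : realType}.
Implicit Types (f g : R -> R) (t m n : R).

Lemma left_slope_leD f g t m n : left_slope_le f t m -> left_slope_le g t n ->
  left_slope_le (fun s => f s + g s) t (m + n).
Proof.
move=> fm gn e e0; have e2 : 0 < e / 2 by lra.
near=> s; have h1 : f t - f s <= (m + e / 2) * (t - s) by near: s; exact: fm.
have h2 : g t - g s <= (n + e / 2) * (t - s) by near: s; exact: gn.
lra.
Unshelve. all: by end_near. Qed.

Lemma left_slope_leZ f t m (k : R) : 0 <= k -> left_slope_le f t m ->
  left_slope_le (fun s => k * f s) t (k * m).
Proof.
move=> k0 fm e e0; have e' : 0 < e / (k + 1) by rewrite divr_gt0// ltr_wpDl.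
near=> s; have h1 : f t - f s <= (m + e / (k + 1)) * (t - s).
  by near: s; exact: fm.
have st : s < t by near: s; exact: nbhs_left_lt.
have ke : k * (e / (k + 1)) <= e.
  by rewrite mulrA ler_pdivrMr ?ltr_wpDl//; nra.
have := ler_wpM2l k0 h1.
by have : 0 <= (e - k * (e / (k + 1))) * (t - s);
  [rewrite mulr_ge0// subr_ge0// ltW|nra].
Unshelve. all: by end_near. Qed.

Lemma left_slope_le_weak f t m n : m <= n ->
  left_slope_le f t m -> left_slope_le f t n.
Proof.
move=> mn fm e e0; near=> s; have st : s < t by near: s; exact: nbhs_left_lt.
apply: (@le_trans _ _ ((m + e) * (t - s))); first by near: s; exact: fm.
by rewrite ler_wpM2r ?lerD2r// subr_ge0 ltW.
Unshelve. all: by end_near. Qed.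

Lemma left_slope_le_lin (k t : R) : left_slope_le (fun s => k * s) t k.
Proof.
move=> e e0; near=> s; have st : s < t by near: s; exact: nbhs_left_lt.
have : 0 <= e * (t - s) by rewrite mulr_ge0 ?subr_ge0// ltW.
by lra.
Unshelve. all: by end_near. Qed.

End left_slope.

(** * Monotonicity from almost everywhere left slopes *)

Section ac_comparison.
Context {R : realType}.
Let mu := @lebesgue_measure R.

Let step_family n (s : R) (u : 'I_n -> R) (i : 'I_n.+1) : R :=
  if unlift ord0 i is Some j then u j else s.

Let sum_step_family n (s t : R) (u w : 'I_n -> R) (F : R -> R -> R) :
  \sum_(i < n.+1) F (step_family s u i) (step_family t w i) =
  F s t + \sum_(i < n) F (u i) (w i).
Proof.
rewrite big_ord_recl /step_family unlift_none; congr (_ + _).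
by apply: eq_bigr => i _; rewrite liftK.
Qed.

Lemma sum_length_le_measure (n : nat) (u w : 'I_n -> R) (U : set R) :
  measurable U -> (forall i, u i <= w i) ->
  (forall i, `]u i, w i[ `<=` U) ->
  trivIset [set: 'I_n] (fun i => `]u i, w i[%classic) ->
  ((\sum_(i < n) (w i - u i))%:E <= mu U)%E.
Proof.
move=> mU uw sU tI.
have mI (k : 'I_n) : measurable (`]u k, w k[%classic : set R).
  exact: measurable_itv.
rewrite -sumEFin.
under eq_bigr => i _.
  have -> : (w i - u i)%:E = mu `]u i, w i[%classic.
    rewrite /mu lebesgue_measure_itv/= lte_fin; case: ltP => // wu.
    by rewrite (_ : w i = u i) ?subrr//; apply/eqP; rewrite eq_le wu uw.
  over.
rewrite -measure_semi_additive_ord//; last exact: bigsetU_measurable.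
apply: le_measure; rewrite ?inE//; first exact: bigsetU_measurable.
by apply: (big_ind (fun A => A `<=` U)) => // A B AU BU; rewrite subUset.
Qed.

Context (f : R -> R) (a b : R) (ac : abs_continuous_on a b f).

Lemma abs_continuous_on_unif (e : R) : 0 < e -> exists2 d : R, 0 < d &
  forall s t, a <= s -> s <= t -> t <= b -> t - s < d -> `|f t - f s| < e.
Proof.
move=> e0; have [d d0 h] := ac e0; exists d => // s t as_ st tb std.
have := h 1%N (fun=> s) (fun=> t); rewrite !big_ord1; apply => //.
by move=> i j _ _ _; rewrite (ord1 i) (ord1 j).
Qed.

(** The state of the descent at s: increments off U are charged at the rate e, those inside U are
    listed as disjoint intervals to which absolute continuity will apply, and the slack eta lets the
    property pass to an infimum. *)
Let chain (U : set R) (e eta s : R) := exists n (u w : 'I_n -> R),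
  [/\ forall i, [/\ s <= u i, u i <= w i & w i <= b],
      forall i, `]u i, w i[ `<=` U,
      trivIset [set: 'I_n] (fun i => `]u i, w i[%classic) &
      f b - f s <= e * (b - s) + \sum_(i < n) `|f (w i) - f (u i)| + eta].

Let chain_le (U : set R) (e eta s t : R) : s <= t ->
  f t - f s <= e * (t - s) -> chain U e eta t -> chain U e eta s.
Proof.
move=> st h' [n [u [w [uw uU tI h]]]]; exists n, u, w; split => //.
  by move=> i; have [tu ? ?] := uw i; split => //; exact: le_trans tu.
lra.
Qed.

Let chain_step (U : set R) (e eta s t : R) : 0 <= e -> s <= t -> t <= b ->
  `]s, t[ `<=` U -> chain U e eta t -> chain U e eta s.
Proof.
move=> e0 st tb stU [n [u [w [uw uU tI h]]]].
exists n.+1, (step_family s u), (step_family t w); split => //.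
- move=> i; rewrite /step_family; case: unliftP => [j|] _//.
  by have [tu ? ?] := uw j; split => //; exact: le_trans tu.
- by move=> i; rewrite /step_family; case: unliftP => [j|] _//; exact: uU.
- move=> i j _ _; rewrite /step_family.
  case: unliftP => [i'|] -> ; case: unliftP => [j'|] ->//.
  + by move=> /(tI i' j' I I) ->.
  + move=> [y [/= + +]]; rewrite !in_itv/=.
    by have [] := uw i'; move=> *; exfalso; lra.
  + move=> [y [/= + +]]; rewrite !in_itv/=.
    by have [] := uw j'; move=> *; exfalso; lra.
- rewrite (sum_step_family s t u w (fun x y => `|f y - f x|)).
  have := ler_norm (f t - f s); have : 0 <= e * (t - s).
    by rewrite mulr_ge0// subr_ge0.
  lra.
Qed.

(* Creeping from [b] down to [a]: off an open set [U] of small measure that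
   covers the exceptional null set, the slope condition is used; a step inside
   [U] is recorded, and absolute continuity bounds the sum of those steps. *)
Lemma abs_continuous_on_nonincreasing : a <= b ->
  {ae mu, forall t, a < t -> t <= b -> left_slope_le f t 0} -> f b <= f a.
Proof.
move=> ab [N [mN N0 NP]]; apply/ler_addgt0Pr => eps eps0.
(* Shares of eps: e (b - a) <= eps / 2 for the steps off U, eps / 4 for the steps inside U and eps /
   4 for the slack; the + 1 covers a = b. *)
pose e := eps / (2 * (b - a + 1)).
have e0 : 0 < e by rewrite divr_gt0// mulr_gt0//; lra.
have e4 : 0 < eps / 4 by lra.
have [d d0 dP] := ac e4.
have N_fin : (mu N < +oo)%E by rewrite N0.
have [U [oU NU UN]] := lebesgue_regularity_outer mN N_fin d0.
have mU : measurable U by exact: open_measurable.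
have Ud : (mu U < d%:E)%E.
  apply: (@le_lt_trans _ _ (mu (U `\` N) + mu N)%E); last by rewrite N0 adde0.
  apply: (@le_trans _ _ (mu ((U `\` N) `|` N))); last first.
    by apply: measureU2 => //; exact: measurableD.
  apply: le_measure; rewrite ?inE//.
    by apply: measurableU => //; exact: measurableD.
  by move=> t Ut; have [?|?] := pselect (N t); [right|left].
pose A := [set s | [/\ a <= s, s <= b & forall eta, 0 < eta -> chain U e eta s]].
have Ab : A b.
  split => // eta eta0; exists 0%N, (fun=> 0), (fun=> 0); split => [[]//|[]//|[]//|].
  by rewrite big_ord0; lra.
have lA : has_lbound A by exists a => s [].
have iA : has_inf A by split => //; exists b.
set c := inf A.
have ac' : a <= c by apply: lb_le_inf; [exists b|move=> s []].
have cb : c <= b by exact: ge_inf.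
(* By uniform continuity half of the slack absorbs f s - f c for some s in A close to c. *)
have Ac : A c.
  split => // eta eta0; have eta2 : 0 < eta / 2 by lra.
  have [d' d'0 d'P] := abs_continuous_on_unif eta2.
  have [s [as_ sb As] sc] := inf_adherent d'0 iA.
  have cs : c <= s by apply: ge_inf => //; split.
  have [n [u [w [uw uU tI h]]]] := As _ eta2.
  exists n, u, w; split => //.
    by move=> i; have [tu ? ?] := uw i; split => //; exact: le_trans tu.
  have := d'P c s ac' cs sb; rewrite ltrBlDl => /(_ sc) /(le_lt_trans (ler_norm _)).
  have : 0 <= e * (s - c) by rewrite mulr_ge0 ?subr_ge0// ltW.
  lra.
(* Otherwise one more step goes below c: an interval inside U if c is in U, and else a step allowed
   by the slope at c, which is not exceptional. *)
have ca : c = a.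
  apply/eqP; rewrite eq_le ac' andbT leNgt; apply/negP => a_c.
  suff [s [as_ sc] As] : exists2 s, a <= s /\ s < c &
      forall eta, 0 < eta -> chain U e eta s.
    suff : c <= s by rewrite leNgt sc.
    by apply: ge_inf => //; split => //; exact: (le_trans (ltW sc)).
  case: Ac => _ _ Ac; have [Uc|Uc] := pselect (U c).
    have [r /= r0 rU] : nbhs c U by exact: open_nbhs_nbhs.
    exists (Num.max a (c - r / 2)).
      by rewrite le_max lexx/= gt_max a_c/=; split => //; lra.
    move=> eta /Ac; apply: chain_step => //; first exact: ltW.
      by rewrite ge_max ltW//=; lra.
    move=> y /=; rewrite in_itv/= gt_max => /andP[/andP[_ h1] h2].
    by apply: rU; rewrite /ball_/= gtr0_norm; lra.
  have slope : left_slope_le f c 0.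
    apply: contrapT => h; apply: Uc; apply: NU; apply: NP => /= h'.
    exact/h/h'.
  near c^'- => s; exists s.
    split; first by near: s; exact: nbhs_left_ge.
    by near: s; exact: nbhs_left_lt.
  move=> eta /Ac; apply: chain_le.
    by near: s; exact: nbhs_left_le.
  by rewrite -[e]add0r; near: s; exact: slope.
case: Ac => _ _ /(_ _ e4); rewrite ca => -[n [u [w [uw uU tI h]]]].
have /= S : \sum_(i < n) (w i - u i) < d.
  rewrite -lte_fin; apply: le_lt_trans Ud; apply: sum_length_le_measure => //.
  by move=> i; have [] := uw i.
have := dP n u w uw tI S.
have : e * (b - a) <= eps / 2.
  by rewrite /e invfM mulrA -mulrA ler_piMr//; [lra|rewrite mulrC ler_pdivrMr; lra].
lra.
Unshelve. all: by end_near. Qed.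

End ac_comparison.

Section ac_domination.
Context {R : realType} {H : completeNormedModType R}.

Lemma abs_continuous_on_dominated (x : R -> H) (f : R -> R) (a b C : R) :
  abs_continuous_on a b x ->
  (forall s t, a <= s -> s <= t -> t <= b -> `|f t - f s| <= C * `|x t - x s|) ->
  abs_continuous_on a b f.
Proof.
move=> ac fx e e0; pose C' := `|C| + 1.
have C'0 : 0 < C' by rewrite /C' ltr_pwDr.
have [d d0 dP] := ac (e / C') (divr_gt0 e0 C'0).
exists d => // n s t st tI sd; have := dP n s t st tI sd.
rewrite ltr_pdivlMr// mulr_suml; apply: le_lt_trans; apply: ler_sum => i _.
have [h1 h2 h3] := st i; rewrite (le_trans (fx _ _ h1 h2 h3))// mulrC.
by rewrite ler_wpM2l// /C' (le_trans (ler_norm _))// lerDl.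
Qed.

Lemma abs_continuous_on_lipschitz (f : R -> R) (a b C : R) :
  (forall s t, a <= s -> s <= t -> t <= b -> `|f t - f s| <= C * (t - s)) ->
  abs_continuous_on a b f.
Proof.
move=> fC e e0; pose C' := `|C| + 1.
have C'0 : 0 < C' by rewrite /C' ltr_pwDr.
exists (e / C') => [|n s t st tI]; first exact: divr_gt0.
rewrite ltr_pdivlMr// mulr_suml; apply: le_lt_trans; apply: ler_sum => i _.
have [h1 h2 h3] := st i; rewrite (le_trans (fC _ _ h1 h2 h3))// mulrC.
by rewrite ler_wpM2l ?subr_ge0// /C' (le_trans (ler_norm _))// lerDl.
Qed.

Lemma abs_continuous_onD (E F : completeNormedModType R) (x : R -> E)
    (y : R -> F) (G : completeNormedModType R) (f : R -> G) (a b : R) :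
  abs_continuous_on a b x -> abs_continuous_on a b y ->
  (forall s t, a <= s -> s <= t -> t <= b ->
     `|f t - f s| <= `|x t - x s| + `|y t - y s|) ->
  abs_continuous_on a b f.
Proof.
move=> acx acy fxy e e0; have e2 : 0 < e / 2 by lra.
have [d d0 dP] := acx _ e2; have [d' d'0 d'P] := acy _ e2.
exists (Num.min d d') => [|n s t st tI]; first by rewrite lt_min d0.
rewrite lt_min => /andP[h h'].
rewrite (splitr e); apply: le_lt_trans (ltrD (dP _ _ _ st tI h) (d'P _ _ _ st tI h')).
rewrite -big_split/=; apply: ler_sum => i _.
by have [h1 h2 h3] := st i; exact: fxy.
Qed.

Lemma abs_continuous_on_shift (x : R -> H) (a b h : R) :
  abs_continuous_on (a + h) (b + h) x ->
  abs_continuous_on a b (fun t => x (t + h)).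
Proof.
move=> ac e e0; have [d d0 dP] := ac e e0; exists d => // n s t st tI sd.
apply: (dP n (fun i => s i + h) (fun i => t i + h)) => //.
- by move=> i; have [? ? ?] := st i; rewrite !lerD2r.
- move=> i j _ _ [y [/= yi yj]]; apply: tI => //; exists (y - h).
  by split => /=; move: yi yj; rewrite !in_itv/=; lra.
- by under eq_bigr do rewrite opprD addrACA subrr addr0.
Qed.

Lemma left_slope_increment (f : R -> R) (a b m : R) : a <= b ->
  abs_continuous_on a b f ->
  {ae @lebesgue_measure R, forall t, a < t -> t <= b -> left_slope_le f t m} ->
  f b - f a <= m * (b - a).
Proof.
move=> ab acf fm; suff : f b + (- m) * b <= f a + (- m) * a by lra.
apply: (@abs_continuous_on_nonincreasing _ (fun t => f t + (- m) * t) a b) => //.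
  apply: (abs_continuous_onD (x := f) (y := fun t => (- m) * t)) => //.
    apply: (abs_continuous_on_lipschitz (C := `|m|)) => s t _ st _.
    by rewrite -mulrBr normrM normrN (ger0_norm (_ : 0 <= t - s)) ?subr_ge0.
  move=> s t _ _ _; rewrite opprD addrACA; exact: ler_normD.
apply: filterS fm; first exact: (ae_filter_ringOfSetsType (@lebesgue_measure R)).
move=> t fm at_ tb; rewrite -[0](subrr m).
by apply: left_slope_leD; [exact: fm|exact: left_slope_le_lin].
Qed.

End ac_domination.

Section ae_shift.
Context {R : realType}.
Let mu := @lebesgue_measure R.

(** The image of Lebesgue measure under the shift agrees with it on half-open intervals, hence
    everywhere, so translates of null sets are null. This gives the inclusion at t and t + h
    simultaneously. *)
Lemma ae_shift (P : set R) (h : R) :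
  {ae mu, forall t, P t} -> {ae mu, forall t, P (t + h)}.
Proof.
move=> [A [mA A0 AP]].
pose shf : measurableTypeR R -> measurableTypeR R := fun t => t + h.
have mf : measurable_fun [set: measurableTypeR R] shf.
  by apply: measurable_funD => //; exact: measurable_cst.
exists (shf @^-1` A); split.
- by rewrite -[X in measurable X]setTI; exact: mf.
- pose nu' : {measure set (measurableTypeR R) -> \bar R} := pushforward mu shf.
  pose nu := nu' mf.
  have E (X : set R) : ocitv X -> mu X = nu X.
    move=> /ocitvP[->|[[u v] /= uv ->]]; first by rewrite !measure0.
    rewrite /nu /nu' /= /pushforward.
    rewrite [X in _ = mu X](_ : _ = `]u - h, v - h]%classic); last first.
      by apply/seteqP; split => y /=; rewrite /shf !in_itv/=; lra.
    rewrite /mu !lebesgue_measure_itv/= !lte_fin ltrD2r uv.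
    by rewrite -!EFinB; congr EFin; lra.
  by have := lebesgue_measure_unique E mA; rewrite -/mu A0 => /esym.
- by move=> t /= Pt; apply: AP.
Qed.
End ae_shift.

Lemma subrACA (V : zmodType) (a b c d : V) : a - b - (c - d) = a - c - (b - d).
Proof. by rewrite !opprD addrACA. Qed.

(** * Left derivatives of curves in H *)

Section left_derivative.
Context {R : realType} {H : completeNormedModType R} (dot : {dot H for @idfun R}).
Context (dot_norm : induces_norm dot).

Definition left_derivative (y : R -> H) (t : R) (v : H) : Prop :=
  forall e : R, 0 < e ->
    \forall s \near t^'-, `|y t - y s - (t - s) *: v| <= e * (t - s).

Lemma derivable_approx (y : R -> H) (t : R) : derivable y t 1 ->
  forall e : R, 0 < e -> exists2 r : R, 0 < r &
    forall h, `|h| < r -> `|y (t + h) - y t - h *: derive1 y t| <= e * `|h|.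
Proof.
move=> dy e e0.
have cy : h^-1 *: (y (h + t) - y t) @[h --> 0^'] --> derive1 y t.
  move: dy; rewrite /derivable /derive1.
  by under eq_fun do rewrite /= [_ *: 1]mulr1.
have /cvgr_dist_le/(_ e e0) := cy.
rewrite near_withinE => /nbhs_ballP[r /= r0 rP]; exists r => // h hr.
have [->|h0] := eqVneq h 0.
  by rewrite addr0 subrr scale0r subr0 !normr0 mulr0.
have -> : y (t + h) - y t - h *: derive1 y t =
    - (h *: (derive1 y t - h^-1 *: (y (h + t) - y t))).
  by rewrite scalerBr scalerA divff// scale1r opprB (addrC h t).
rewrite normrN normrZ mulrC ler_wpM2r//; apply: rP => //.
by rewrite /ball/= sub0r normrN.
Qed.

Lemma derivable_left_derivative_shift (y : R -> H) (t h : R) :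
  derivable y (t + h) 1 ->
  left_derivative (fun s => y (s + h)) t (derive1 y (t + h)).
Proof.
move=> dy e e0; have [r r0 rP] := derivable_approx dy e0.
near=> s; have st : s < t by near: s; exact: nbhs_left_lt.
have := rP (s - t); rewrite distrC gtr0_norm ?subr_gt0//.
rewrite (_ : t + h + (s - t) = s + h); last lra.
have -> : y (s + h) - y (t + h) - (s - t) *: derive1 y (t + h) =
    - (y (t + h) - y (s + h) - (t - s) *: derive1 y (t + h)).
  by rewrite !opprB -[s - t]opprB scaleNr opprK addrC.
rewrite normrN; apply; near: s; exact: nbhs_left_ltBl.
Unshelve. all: by end_near. Qed.

Lemma derivable_left_derivative (y : R -> H) (t : R) :
  derivable y t 1 -> left_derivative y t (derive1 y t).
Proof.
rewrite -{1 3}[t]addr0 => /derivable_left_derivative_shift.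
by under [X in left_derivative X]eq_fun do rewrite addr0.
Qed.

Lemma left_derivativeB (y z : R -> H) (t : R) (v w : H) :
  left_derivative y t v -> left_derivative z t w ->
  left_derivative (fun s => y s - z s) t (v - w).
Proof.
move=> dy dz e e0; have e2 : 0 < e / 2 by lra.
near=> s; have h1 : `|y t - y s - (t - s) *: v| <= e / 2 * (t - s).
  by near: s; exact: dy.
have h2 : `|z t - z s - (t - s) *: w| <= e / 2 * (t - s).
  by near: s; exact: dz.
have -> : y t - z t - (y s - z s) - (t - s) *: (v - w) =
    (y t - y s - (t - s) *: v) - (z t - z s - (t - s) *: w).
  by rewrite scalerBr [X in X - _]subrACA [LHS]subrACA.
apply: (le_trans (ler_normB _ _)); lra.
Unshelve. all: by end_near. Qed.

(** The hypothesis on f has the form of a subgradient inequality at y(t); it is met by the squared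
    norm, with w = 2 y(t), and by Phi plus a linear term along the orbit. *)
Lemma left_slope_le_dot (y : R -> H) (f : R -> R) (t : R) (v w : H) :
  left_derivative y t v ->
  (\forall s \near t^'-, f t - f s <= dot w (y t - y s)) ->
  left_slope_le f t (dot w v).
Proof.
move=> dy fy e e0; pose e' := e / (`|w| + 1).
have w1 : 0 < `|w| + 1 by rewrite ltr_wpDl.
have e'0 : 0 < e' by rewrite divr_gt0.
near=> s; have st : s < t by near: s; exact: nbhs_left_lt.
have h1 : `|y t - y s - (t - s) *: v| <= e' * (t - s) by near: s; exact: dy.
have h2 : f t - f s <= dot w (y t - y s) by near: s; exact: fy.
have := dot_le_norm dot_norm w (y t - y s - (t - s) *: v).
rewrite dotBr dotZr => h3.
have : `|w| * `|y t - y s - (t - s) *: v| <= e * (t - s).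
  apply: (@le_trans _ _ ((`|w| + 1) * (e' * (t - s)))).
    by apply: ler_pM => //; rewrite lerDl.
  by rewrite mulrA /e' mulrCA divff ?mulr1 ?gt_eqF.
lra.
Unshelve. all: by end_near. Qed.

Lemma left_slope_sqr_norm (y : R -> H) (t : R) (v : H) :
  left_derivative y t v ->
  left_slope_le (fun s => `|y s| ^+ 2) t (2 * dot (y t) v).
Proof.
move=> dy; rewrite -dotZl; apply: (left_slope_le_dot dy).
apply: nearW => s; rewrite dotZl dotBr.
have := sqr_ge0 `|y t - y s|; rewrite (sqr_normB dot_norm) -(dot_norm (y t)).
lra.
Qed.

Lemma left_slope_sqr_dist (y : R -> H) (u : H) (t : R) (v : H) :
  left_derivative y t v ->
  left_slope_le (fun s => `|y s - u| ^+ 2) t (2 * dot (y t - u) v).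
Proof.
move=> dy; rewrite -[v]subr0; apply: left_slope_sqr_norm.
apply: left_derivativeB => // e e0; near=> s.
by rewrite subrr scaler0 subr0 normr0 mulr_ge0 ?ltW// subr_gt0.
Unshelve. all: by end_near. Qed.

End left_derivative.

(** Stated as l <= f t < l + e to show that f cannot drop by e after T, which is how large values of
    |e| and |x'| are excluded. *)
Lemma nonincreasing_pinfty_limit (R : realType) (f : R -> R) (a m : R) :
  (forall s t, a <= s -> s <= t -> f t <= f s) ->
  (forall t, a <= t -> m <= f t) ->
  exists l : R, forall e, 0 < e -> exists2 T, a <= T &
    forall t, T <= t -> l <= f t /\ f t < l + e.
Proof.
move=> fni fm; pose A := f @` [set t | a <= t].
have lA : has_lbound A by exists m => _ [t /= at_ <-]; exact: fm.
have iA : has_inf A by split => //; exists (f a); exists a => /=.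
exists (inf A) => e e0; have [_ [T /= aT <-] Tl] := inf_adherent e0 iA.
exists T => // t Tt; split; last exact: le_lt_trans (fni _ _ aT Tt) Tl.
by apply: ge_inf => //; exists t => //=; exact: le_trans Tt.
Qed.

Section lebesgue_ae.
Context {R : realType}.
Let mu := @lebesgue_measure R.

Lemma ae_dense (P : set R) (u v : R) :
  {ae mu, forall t, P t} -> u < v -> exists t, [/\ u < t, t < v & P t].
Proof.
move=> [A [mA A0 AP]] uv; apply: contrapT => h.
have : (mu `]u, v[%classic <= mu A)%E.
  apply: le_measure; rewrite ?inE//.
  move=> t /=; rewrite in_itv/= => /andP[ut tv].
  by apply: AP => /= Pt; apply: h; exists t.
by rewrite A0 /mu lebesgue_measure_itv/= lte_fin uv -EFinB lee_fin leNgt subr_gt0 uv.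
Qed.
End lebesgue_ae.

(** * Measurability and integration of the speed *)

Section speed_measurable.
Context {R : realType} {H : completeNormedModType R}.
Context (x : R -> H) (x_cont : forall t, 0 < t -> {for t, continuous x}).

Let quotient (h t : R) : H := h^-1 *: (x (h + t) - x t).

Let derivableE (t : R) : derivable x t 1 = cvg (quotient h t @[h --> 0^']).
Proof.
rewrite /derivable /quotient.
by under eq_fun do rewrite /= [_ *: 1]mulr1.
Qed.

Let quotient_continuous (h t : R) : 0 < t -> 0 < h + t ->
  {for t, continuous (quotient h)}.
Proof.
move=> t0 ht0; apply: cvgZl_tmp; apply: cvgB; last exact: x_cont.
apply: (@cvg_comp _ _ _ (fun s => h + s) x _ (nbhs (h + t))); last exact: x_cont.
by apply: cvgD; [exact: cvg_cst|exact: cvg_id].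
Qed.

(* The measurable sets of R are the Borel sets, so the set of times where [x] is
   derivable has to be exhibited as a Borel set. *)
Let cauchy_times (e d : R) : set R := [set t | d <= t /\
  forall h k, 0 < `|h| -> `|h| < d -> 0 < `|k| -> `|k| < d ->
    `|quotient h t - quotient k t| <= e].

(** d <= t keeps h + t positive whenever |h| < d; the quotients are then continuous in t, and weak
    inequalities survive limits. *)
Let cauchy_times_closed (e d : R) : 0 < d -> closed (cauchy_times e d).
Proof.
move=> d0 t clt.
have dt : d <= t.
  apply/ler_addgt0Pr => r r0; have [s [[ds _]]] := clt _ (nbhsx_ballx t r r0).
  by rewrite -ball_normE/= distrC => /ltr_normlW; lra.
split => // h k h0 hm k0 km; rewrite leNgt; apply/negP => hk.
have t0 : 0 < t by lra.
have ht0 : 0 < h + t by have := ler_norm (- h); rewrite normrN; lra.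
have kt0 : 0 < k + t by have := ler_norm (- k); rewrite normrN; lra.
have c : (fun s => `|quotient h s - quotient k s|) @ t -->
    `|quotient h t - quotient k t|.
  by apply: cvg_norm; apply: cvgB; exact: quotient_continuous.
have [s [[_ sP] /=]] := clt _ (cvgr_gt _ c _ hk).
by rewrite ltNge sP.
Qed.

(** The Cauchy criterion for the difference quotients, equivalent to convergence since H is
    complete; countably many tolerances and radii suffice. *)
Let derivable_timesE : [set t | 0 < t /\ derivable x t 1] =
  \bigcap_n \bigcup_m cauchy_times n.+1%:R^-1 m.+1%:R^-1.
Proof.
apply/seteqP; split => t /=.
  move=> [t0]; rewrite derivableE => ct n _.
  have : 0 < n.+1%:R^-1 :> R by rewrite invr_gt0.
  move: (n.+1%:R^-1) => e e0; have n0 : 0 < e / 2 by lra.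
  have /cvgr_dist_lt/(_ _ n0) := ct.
  rewrite near_withinE => /nbhs_ballP[r /= r0 rP].
  have r't : 0 < Num.min r t by rewrite lt_min r0.
  have [m mr] : exists m, m.+1%:R^-1 < Num.min r t.
    exists (Num.truncn (Num.min r t)^-1).
    by rewrite invf_plt ?posrE// truncnS_gt.
  have [mr1 mt1] : m.+1%:R^-1 < r /\ m.+1%:R^-1 < t.
    by move: mr; rewrite lt_min => /andP.
  exists m => //; split; first exact: ltW.
  have near_l h : 0 < `|h| -> `|h| < m.+1%:R^-1 ->
      `|lim (quotient h t @[h --> 0^']) - quotient h t| < e / 2.
    rewrite normr_gt0 => h0 hm; apply: rP => //.
    by rewrite /ball/= sub0r normrN; exact: lt_trans mr1.
  move=> h k h0 hm k0 km.
  have h1 := near_l h h0 hm; have h2 := near_l k k0 km.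
  have := ler_distD (lim (quotient h t @[h --> 0^'])) (quotient h t) (quotient k t).
  by rewrite (distrC (quotient h t) (lim _)); lra.
move=> tP; have t0 : 0 < t.
  have [m _ [mt _]] := tP 0%N I; apply: lt_le_trans mt; by rewrite invr_gt0.
split => //; rewrite derivableE; apply: cauchy_cvg; apply: cauchy_exP => e e0.
have [n ne] : exists n, n.+1%:R^-1 < e.
  exists (Num.truncn e^-1); by rewrite invf_plt ?posrE// truncnS_gt.
have [m _ [_ mP]] := tP n I.
have m0 : 0 < m.+1%:R^-1 :> R by rewrite invr_gt0.
pose h := m.+1%:R^-1 / 2 :> R.
have h0 : 0 < h by rewrite divr_gt0.
have hm : h < m.+1%:R^-1 by move: m0; rewrite /h; move: (m.+1%:R^-1) => d; lra.
exists (quotient h t).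
suff : \forall k \near 0^', ball (quotient h t) e (quotient k t) by [].
near=> k; rewrite -ball_normE/=.
apply: le_lt_trans ne; apply: mP; rewrite ?(gtr0_norm h0)//.
  by rewrite normr_gt0; near: k; exact: nbhs_dnbhs_neq.
by near: k; exact: dnbhs0_lt.
Unshelve. all: by end_near. Qed.

Lemma measurable_derivable_times : measurable [set t | 0 < t /\ derivable x t 1].
Proof.
rewrite derivable_timesE; apply: bigcapT_measurable => n.
apply: bigcupT_measurable => m; apply: closed_measurable.
by apply: cauchy_times_closed; rewrite invr_gt0.
Qed.

Lemma measurable_speed :
  measurable_fun (`]0, +oo[%classic : set R) (fun t : R => `|derive1 x t|).
Proof.
have mD := measurable_derivable_times; set D := [set t | _] in mD.
have mpos : measurable (`]0, +oo[%classic : set R) by exact: measurable_itv.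
have -> : `]0, +oo[%classic = D `|` (`]0, +oo[%classic `\` D).
  apply/seteqP; split => t /=.
    by move=> t0; have [?|?] := pselect (D t); [left|right].
  by move=> [[t0 _]|[]//]; rewrite in_itv/= t0.
apply/measurable_funU => //; first exact: measurableD.
split; last first.
  (* Where x is not derivable, [derive1] takes the default value [point], so the speed is constant
     on this set. *)
  apply: (eq_measurable_fun (cst `|point : H|)); last exact: measurable_cst.
  move=> t; rewrite inE => -[/=]; rewrite in_itv/= andbT => t0 nD.
  have nd : ~ derivable x t 1 by move=> dt; apply: nD.
  by rewrite /derive1 dvgP// -[X in ~ X](derivableE t).
pose f (n : nat) t := `|quotient n.+1%:R^-1 t|.
apply: (@measurable_fun_cvg _ _ _ _ f) => [n|t [t0 dt]].
  apply: (measurable_funS mpos); first by move=> t [t0 _]; rewrite /= in_itv/= t0.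
  apply: open_continuous_measurable_fun; first exact: interval_open.
  move=> t; rewrite inE/= in_itv/= andbT => t0; apply: cvg_norm.
  by apply: quotient_continuous => //; rewrite addr_gt0.
apply: cvg_norm; move: dt; rewrite derivableE => dt.
apply: (@cvg_comp _ _ _ (fun n : nat => n.+1%:R^-1 : R) (quotient^~ t) _ (0^')).
  move=> A [r /= r0 rA].
  near=> n; apply: rA; last by rewrite /= gt_eqF.
  rewrite /ball/= sub0r normrN gtr0_norm ?invr_gt0//.
  near: n; exact: near_infty_natSinv_lt (PosNum r0).
exact: dt.
Unshelve. all: by end_near. Qed.

End speed_measurable.

Section integral_of_slope.
Context {R : realType}.
Let mu := @lebesgue_measure R.

Lemma derivable_left_slope (f : R -> R) (t : R) :
  derivable f t 1 -> left_slope_le f t (derive1 f t).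
Proof.
move=> df e e0; have h := derivable_left_derivative (H := R) df e0.
near=> s; have : `|f t - f s - (t - s) *: derive1 f t| <= e * (t - s).
  by near: s; exact: h.
by move=> /(le_trans (ler_norm _)); rewrite [_ *: _]mulrC; lra.
Unshelve. all: by end_near. Qed.

(** The primitive F of g is Lipschitz because g is bounded, and has derivative g almost everywhere;
    E + F then has left slope at most 0, which bounds F b by E a - E b without any integral formula
    for E. *)
Lemma integral_le_decrement (E g : R -> R) (a b C : R) : a <= b ->
  measurable_fun (`]a, b]%classic : set R) g ->
  (forall t, a < t -> t <= b -> 0 <= g t <= C) ->
  abs_continuous_on a b E ->
  {ae mu, forall t, a < t -> t <= b -> left_slope_le E t (- g t)} ->
  (\int[mu]_(t in `]a, b]) (g t)%:E <= (E a - E b)%:E)%E.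
Proof.
move=> ab mg gC acE slopeE.
have mI (c d : R) : measurable (`]c, d]%classic : set R) by exact: measurable_itv.
have mu_fin (c d : R) : (mu `]c, d]%classic < +oo)%E.
  by rewrite /mu lebesgue_measure_itv/= lte_fin; case: ifP => _; rewrite -?EFinB ltry.
pose f := g \_ `]a, b].
have fE t : a < t -> t <= b -> f t = g t.
  by move=> at_ tb; rewrite /f patchE ifT// inE/= in_itv/= at_ tb.
have ig : mu.-integrable `]a, b] (EFin \o g).
  apply: measurable_bounded_integrable => //.
  exists C; split; first exact: num_real.
  move=> M CM t /=; rewrite in_itv/= => /andP[at_ tb].
  by have /andP[g0 gM] := gC t at_ tb; rewrite ger0_norm// (le_trans gM)// ltW.
have if_ : mu.-integrable [set: R] (EFin \o f).
  rewrite /f -restrict_EFin; apply: (integrable_mkcond (mu := mu) _ _).1 => //.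
have ifI (c d : R) : mu.-integrable `]c, d] (EFin \o f).
  by apply: integrableS if_.
pose F (y : R) := (\int[mu]_(t in `]a, y]) f t)%R.
have Fa : F a = 0.
  by rewrite /F set_itvoc0 Rintegral_set0.
have Fincr s t : a <= s -> s <= t -> t <= b -> 0 <= F t - F s <= C * (t - s).
  move=> as_ st tb.
  have -> : F t - F s = (\int[mu]_(r in `]s, t]) f r)%R.
    by apply: Rintegral_itvB; [exact: ifI|rewrite bnd_simp|rewrite bnd_simp].
  have fC r : r \in `]s, t] -> 0 <= f r <= C.
    by rewrite in_itv/= => /andP[sr rt]; rewrite fE ?gC//; lra.
  apply/andP; split.
    by apply: Rintegral_ge0 => r /fC /andP[].
  have ic : mu.-integrable `]s, t] (EFin \o cst C).
    apply: measurable_bounded_integrable => //.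
    exists `|C|; split; first exact: num_real.
    by move=> M CM r _ /=; rewrite ltW.
  have -> : C * (t - s) = (\int[mu]_(r in `]s, t]) (cst C) r)%R.
    have mu_st : mu `]s, t]%classic = (t - s)%:E.
      rewrite /mu lebesgue_measure_itv/= lte_fin; have [//|ts] := ltP s t.
      by rewrite (_ : t = s) ?subrr//; apply/eqP; rewrite eq_le st ts.
    by rewrite Rintegral_cst// -[t - s]/(fine (t - s)%:E) -mu_st.
  by apply: le_Rintegral => // r /fC /andP[].
have slopeF : {ae mu, forall t, a < t -> t <= b -> left_slope_le F t (g t)}.
  have := @FTC1 _ f (BRight a) (ifI a) (open_integrable_locally openT if_).
  apply: filterS; first exact: (ae_filter_ringOfSetsType mu).
  move=> t dF at_ tb; have [|dFt Ft] := dF; first exact: at_.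
  by rewrite -(fE t at_ tb) -Ft; exact: derivable_left_slope.
have : E b + F b - (E a + F a) <= 0 * (b - a).
  apply: (@left_slope_increment _ (fun t => E t + F t)) => //.
    apply: (abs_continuous_onD (x := E) (y := F)) => //.
      apply: (abs_continuous_on_lipschitz (C := C)) => s t as_ st tb.
      by have /andP[h0 h1] := Fincr s t as_ st tb; rewrite ger0_norm.
    by move=> s t _ _ _; rewrite opprD addrACA ler_normD.
  apply: filterS2 slopeE slopeF; first exact: (ae_filter_ringOfSetsType mu).
  move=> t h1 h2 at_ tb; rewrite -(addNr (g t)).
  by apply: left_slope_leD; [exact: h1|exact: h2].
rewrite Fa mul0r => h.
have -> : (\int[mu]_(t in `]a, b]) (g t)%:E = (F b)%:E)%E.
  rewrite /F /Rintegral fineK; last exact: integrable_fin_num.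
  by apply: eq_integral => t; rewrite inE/= in_itv/= => /andP[at_ tb]; rewrite fE.
rewrite lee_fin; lra.
Qed.

End integral_of_slope.

Lemma ge0_integral_exhaustion d (T : measurableType d) (R : realType)
    (mu : {measure set T -> \bar R}) (f : T -> \bar R) (D : set T)
    (I : (set T)^nat) (C : \bar R) :
  measurable_fun D f -> measurable D -> (forall t, D t -> (0 <= f t)%E) ->
  nondecreasing_seq I -> (forall n, measurable (I n)) -> \bigcup_n I n = D ->
  (forall n, \int[mu]_(t in I n) f t <= C)%E -> (\int[mu]_(t in D) f t <= C)%E.
Proof.
move=> mf mD f0 ndI mI ID fC.
have ImD n : I n `<=` D by rewrite -ID; exact: bigcup_sup.
have := @ge0_nondecreasing_set_cvg_integral _ _ _ _ f mu ndI mI.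
rewrite ID => h; apply: (cvge_to_le (h _ _)).
- by move=> n; exact: measurable_funS mf.
- by move=> n t /ImD; exact: f0.
- exact: nearW.
Qed.

Lemma abs_continuous_on_sqr_dist (R : realType) (H : completeNormedModType R)
    (y : R -> H) (u : H) (a b M : R) :
  (forall t, a <= t -> t <= b -> `|y t| <= M) ->
  abs_continuous_on a b y ->
  abs_continuous_on a b (fun t => `|y t - u| ^+ 2).
Proof.
move=> yM ac; apply: (abs_continuous_on_dominated (C := 2 * (M + `|u|)) ac).
move=> s t as_ st tb; rewrite subr_sqr normrM mulrC.
have yuM r : a <= r -> r <= b -> `|y r - u| <= M + `|u|.
  by move=> ar rb; rewrite (le_trans (ler_normB _ _))// lerD2r yM.
apply: ler_pM => //.
  have := yuM s as_ (le_trans st tb); have := yuM t (le_trans as_ st) tb.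
  by rewrite ger0_norm ?addr_ge0//; lra.
apply: le_trans (ler_dist_dist _ _) _.
by rewrite opprB addrA subrK.
Qed.

(** * Orbits *)

Section orbit.
Context {R : realType} {H : completeNormedModType R} (dot : {dot H for @idfun R}).
Context (dot_norm : induces_norm dot).
Context (Phi : H -> \bar R) (Phi_proper : proper_function Phi).
Context (B : H -> H) (B_monotone : monotone_operator dot B).
Context (x : R -> H) (x_orbit : strong_solution dot Phi B x).
Let mu := @lebesgue_measure R.

Definition regular_time (t : R) : Prop := derivable x t 1 /\
  subdifferential dot Phi (x t) (- derive1 x t - B (x t)).

Lemma ae_regular_time : {ae mu, forall t, 0 < t -> regular_time t}.
Proof.
case: x_orbit => _ _; apply: filterS; first exact: (ae_filter_ringOfSetsType mu).
move=> t xt t0.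
have [dx [p Fp xp]] := xt t0; split => //.
move/eqP: xp; rewrite addrAC addr_eq0 => /eqP xp.
by rewrite -opprD xp opprK.
Qed.

Lemma regular_time_dense (s t : R) : 0 <= s -> s < t ->
  exists r, [/\ s < r, r < t & regular_time r].
Proof.
move=> s0 st; have [r [sr rt rr]] := ae_dense ae_regular_time st.
by exists r; split => //; apply: rr; exact: le_lt_trans sr.
Qed.

Lemma subdifferential_fin_num (u p : H) :
  subdifferential dot Phi u p -> Phi u \is a fin_num.
Proof.
move=> up; case: Phi_proper => Phi_gtNy [v Phiv].
rewrite fin_numElt Phi_gtNy/=; have := le_lt_trans (up v) Phiv.
by case: (Phi u) => [r _||_] //; rewrite ?ltry ?ltNyr.
Qed.

Lemma subdifferential_monotone (u v p q : H) :
  subdifferential dot Phi u p -> subdifferential dot Phi v q ->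
  0 <= dot (p - q) (u - v).
Proof.
move=> up vq; have /fineK Pu := subdifferential_fin_num up.
have /fineK Pv := subdifferential_fin_num vq.
have := up v; have := vq u; rewrite -Pu -Pv -!EFinD !lee_fin.
rewrite !(dotBl, dotBr) => h1 h2; lra.
Qed.

Lemma orbit_continuous (t : R) : 0 < t -> {for t, continuous x}.
Proof.
case: x_orbit => cx _ _ t0.
apply: (@within_continuous_continuous _ _ _ 0 (t + 1)); first by lra.
  by apply: continuous_subspaceW cx => r /=; rewrite !in_itv/= => /andP[->].
by rewrite in_itv/= t0 ltrDl ltr01.
Qed.

Lemma orbit_bounded (b : R) : exists M : R, forall t, 0 <= t -> t <= b -> `|x t| <= M.
Proof.
have [b0|b0] := ltP b 0; first by exists 0 => t; lra.
case: x_orbit => cx _ _.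
have cn : {within `[0, b], continuous (fun t => `|x t|)}.
  have : {within `[0, b], continuous x}.
    by apply: continuous_subspaceW cx => r /=; rewrite !in_itv/= => /andP[->].
  by move=> h t; apply: continuous_comp; [exact: h|exact: norm_continuous].
have [c _ cP] := EVT_max b0 cn; exists `|x c| => t t0 tb.
by apply: cP; rewrite in_itv/= t0.
Qed.

Lemma orbit_ac (a b : R) : 0 < a -> a <= b -> abs_continuous_on a b x.
Proof. by case: x_orbit => _ + _; exact. Qed.

Lemma orbit_contraction (s t h : R) : 0 < s -> s <= t -> 0 <= h ->
  `|x (t + h) - x t| <= `|x (s + h) - x s|.
Proof.
move=> s0 st h0; pose y r := x (r + h) - x r.
rewrite -[leLHS]/`|y t| -[leRHS]/`|y s| -(@ler_pXn2r _ 2)// ?nnegrE//.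
apply: (@abs_continuous_on_nonincreasing _ (fun r => `|y r| ^+ 2)) => //.
  have [M MP] := orbit_bounded (t + h).
  have acy : abs_continuous_on s t y.
    apply: (@abs_continuous_onD _ _ _ (fun r => x (r + h)) x).
    - by apply: abs_continuous_on_shift; apply: orbit_ac; lra.
    - exact: orbit_ac.
    - by move=> u v _ _ _; rewrite /y subrACA ler_normB.
  have := @abs_continuous_on_sqr_dist _ _ y 0 s t (M + M) _ acy.
  under eq_fun do rewrite subr0.
  apply => r sr rt; rewrite (le_trans (ler_normB _ _))// lerD// MP//; lra.
have : {ae mu, forall r, 0 < r + h -> regular_time (r + h)}.
  exact: (ae_shift (P := fun r => 0 < r -> regular_time r)) ae_regular_time.
apply: filterS2 ae_regular_time; first exact: (ae_filter_ringOfSetsType mu).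
move=> r rr rhr sr rt.
have [|dr Fr] := rr; first lra.
have [|drh Frh] := rhr; first lra.
have dx' := derivable_left_derivative_shift drh.
have dy := left_derivativeB dx' (derivable_left_derivative dr).
apply: left_slope_le_weak (left_slope_sqr_norm dot_norm dy).
rewrite pmulr_rle0// dotC.
have := subdifferential_monotone Frh Fr.
have := B_monotone (x (r + h)) (x r).
rewrite -/(y r) !(dotBl, dotNl); lra.
Qed.

(** The contraction estimate divided by h, with h small enough for the first-order expansions at
    both times. *)
Lemma speed_nonincreasing (s t : R) : 0 < s -> s <= t ->
  derivable x s 1 -> derivable x t 1 -> `|derive1 x t| <= `|derive1 x s|.
Proof.
move=> s0 st dxs dxt; apply/ler_addgt0Pr => e e0; have e2 : 0 < e / 2 by lra.
have [r1 r10 r1P] := derivable_approx dxs e2.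
have [r2 r20 r2P] := derivable_approx dxt e2.
pose h := Num.min r1 r2 / 2.
have h0 : 0 < h by rewrite divr_gt0// lt_min r10.
have hr : h < r1 /\ h < r2.
  have : h * 2 <= r1 /\ h * 2 <= r2 by rewrite divfK// !ge_min !lexx orbT.
  by split; lra.
have := r1P h; rewrite gtr0_norm// => /(_ hr.1) h1.
have := r2P h; rewrite gtr0_norm// => /(_ hr.2) h2.
have h3 := orbit_contraction s0 st (ltW h0).
have h4 : h * `|derive1 x t| <= `|x (t + h) - x t| + e / 2 * h.
  rewrite -{1}(gtr0_norm h0) -normrZ -lerBlDl; apply: le_trans h2.
  by rewrite [leRHS]distrC; exact: lerB_dist.
have h5 : `|x (s + h) - x s| <= h * `|derive1 x s| + e / 2 * h.
  rewrite -{2}(gtr0_norm h0) -normrZ -lerBlDl; apply: le_trans h1.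
  exact: lerB_dist.
by rewrite -(ler_pM2l h0); lra.
Qed.

(** At one time b < a where x is derivable, increments over short times h are at most L h with L =
    |x'(b)| + 1; contraction carries this to every later time, and longer intervals are cut into
    short ones. *)
Lemma orbit_lipschitz (a : R) : 0 < a -> exists L : R, [/\ 0 <= L,
  forall s t, a <= s -> s <= t -> `|x t - x s| <= L * (t - s) &
  forall t, a <= t -> derivable x t 1 -> `|derive1 x t| <= L].
Proof.
move=> a0; have [b [b0 ba [dxb _]]] := regular_time_dense (lexx 0) a0.
pose L := `|derive1 x b| + 1; have L0 : 0 <= L by rewrite addr_ge0.
exists L; split => // [s t as_ st|t at_ dxt]; last first.
  have := speed_nonincreasing b0 (le_trans (ltW ba) at_) dxb dxt.
  by rewrite /L; lra.
have [r r0 rP] := derivable_approx dxb ltr01.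
have small h c : a <= c -> 0 <= h -> h < r -> `|x (c + h) - x c| <= L * h.
  move=> ac h0 hr; have bc : b <= c by lra.
  apply: (le_trans (orbit_contraction b0 bc h0)).
  have := rP h; rewrite ger0_norm// => /(_ hr) /(le_trans (lerB_dist _ _)).
  by rewrite normrZ ger0_norm// /L; lra.
pose n := (Num.truncn ((t - s) / r)).+1; pose h := (t - s) / n%:R.
have n0 : 0 < n%:R :> R by rewrite ltr0n.
have h0 : 0 <= h by rewrite divr_ge0 ?subr_ge0// ltW.
have hr : h < r.
  by rewrite /h ltr_pdivrMr// mulrC -ltr_pdivrMr// /n truncnS_gt.
have chain k : `|x (s + h *+ k) - x s| <= L * (h *+ k).
  elim: k => [|k IH]; first by rewrite mulr0n addr0 subrr normr0 mulr0.
  have := ler_distD (x (s + h *+ k)) (x (s + h *+ k.+1)) (x s).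
  move=> /le_trans; apply.
  rewrite [in leRHS]mulrS mulrDr lerD// mulrSr addrA small//.
  by rewrite (le_trans as_)// lerDl mulrn_wge0.
have := chain n; rewrite -mulr_natr /h divfK ?gt_eqF//.
by rewrite subrKC.
Qed.

(** * Distance to a zero, and convergence of B along the orbit *)

Context (beta : R) (beta_gt0 : 0 < beta) (B_cocoercive : cocoercive dot beta B).
Context (z : H) (Sz : zeros dot Phi B z).

Lemma zeros_subdifferential : subdifferential dot Phi z (- B z).
Proof.
case: Sz => p Fp /eqP; rewrite addr_eq0 => /eqP pE.
by rewrite -pE.
Qed.

Lemma cocoercive_lipschitz (u v : H) : beta * `|B u - B v| <= `|u - v|.
Proof.
have [->|n0] := eqVneq (B u - B v) 0; first by rewrite normr0 mulr0.
have {}n0 : 0 < `|B u - B v| by rewrite normr_gt0.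
rewrite -(ler_pM2l n0); apply: le_trans (dot_le_norm dot_norm _ _).
by apply: le_trans (B_cocoercive u v); rewrite expr2; lra.
Qed.

(** - x' - Bx at x(t) and - Bz at z are subgradients; monotonicity of the subdifferential is
    combined with cocoercivity of B. *)
Lemma regular_dot_le (t : R) : regular_time t ->
  dot (x t - z) (derive1 x t) <= - (beta * `|B (x t) - B z| ^+ 2).
Proof.
move=> [_ Ft]; rewrite dotC; have := subdifferential_monotone Ft zeros_subdifferential.
have := B_cocoercive (x t) z.
rewrite !(dotBl, dotNl); lra.
Qed.

Lemma dist_slope (t : R) : regular_time t ->
  left_slope_le (fun s => `|x s - z| ^+ 2) t (- (2 * beta * `|B (x t) - B z| ^+ 2)).
Proof.
move=> rt; have := regular_dot_le rt; case: rt => dx _ h.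
have := left_slope_sqr_dist dot_norm z (derivable_left_derivative dx).
apply: left_slope_le_weak; lra.
Qed.

Lemma dist_ac (a b : R) : 0 < a -> a <= b ->
  abs_continuous_on a b (fun t => `|x t - z| ^+ 2).
Proof.
move=> a0 ab; have [M MP] := orbit_bounded b.
apply: (@abs_continuous_on_sqr_dist _ _ x z a b M); last exact: orbit_ac.
by move=> t at_ tb; apply: MP => //; lra.
Qed.

Lemma dist_drop (s t k : R) : 0 < s -> s <= t ->
  (forall r, s < r -> r <= t -> k <= `|B (x r) - B z| ^+ 2) ->
  `|x t - z| ^+ 2 + 2 * beta * k * (t - s) <= `|x s - z| ^+ 2.
Proof.
move=> s0 st kP.
suff : `|x t - z| ^+ 2 - `|x s - z| ^+ 2 <= - (2 * beta * k) * (t - s) by lra.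
apply: (@left_slope_increment _ (fun t => `|x t - z| ^+ 2)) => //.
  exact: dist_ac.
apply: filterS ae_regular_time; first exact: (ae_filter_ringOfSetsType mu).
move=> r rr sr rt; have {}rr : regular_time r by apply: rr; lra.
apply: left_slope_le_weak (dist_slope rr).
have := kP _ sr rt; rewrite lerN2 => h; rewrite ler_pM2l//.
by rewrite mulr_gt0.
Qed.

Lemma dist_nonincreasing (s t : R) : 0 < s -> s <= t ->
  `|x t - z| ^+ 2 <= `|x s - z| ^+ 2.
Proof.
move=> s0 st; have := @dist_drop s t 0 s0 st.
by rewrite mulr0 mul0r addr0; apply => r _ _; exact: sqr_ge0.
Qed.

Lemma dist_limit : exists l : R, forall e, 0 < e -> exists2 T, 1 <= T &
  forall t, T <= t -> l <= `|x t - z| ^+ 2 /\ `|x t - z| ^+ 2 < l + e.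
Proof.
apply: (nonincreasing_pinfty_limit (m := 0)) => [s t s1 st|t _].
  by apply: dist_nonincreasing => //; lra.
exact: sqr_ge0.
Qed.

Lemma dist_cvg : exists l : R, `|x t - z| ^+ 2 @[t --> +oo] --> l.
Proof.
have [l lP] := dist_limit; exists l; apply/cvgrPdist_lt => e e0.
have [T T1 TP] := lP e e0; near=> t; have Tt : T <= t.
  by near: t; apply: nbhs_pinfty_ge; exact: num_real.
have [h1 h2] := TP t Tt; rewrite ltr_norml; lra.
Unshelve. all: by end_near. Qed.

Lemma orbit_bounded_pinfty : exists M : R, forall t, 0 <= t -> `|x t| <= M.
Proof.
have [M MP] := orbit_bounded 1; exists (M + `|z| + `|z|) => t t0.
have [t1|t1] := leP t 1.
  by apply: (le_trans (MP _ t0 t1)); rewrite -addrA lerDl addr_ge0.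
have := dist_nonincreasing ltr01 (ltW t1).
rewrite ler_pXn2r ?nnegrE// => h.
have := MP 1 ler01 (lexx 1); have := ler_normB (x 1) z.
by have := ler_normD (x t - z) z; rewrite subrK; lra.
Qed.

Lemma B_orbit_cvg (e : R) : 0 < e ->
  exists2 T, 1 <= T & forall t, T <= t -> `|B (x t) - B z| < e.
Proof.
move=> e0; have [L [L0 LP _]] := orbit_lipschitz ltr01.
(* In a time d the orbit moves by at most L d <= beta e / 2, hence B(x) by at most e / 2; the + 1
   avoids dividing by 0. *)
pose d := beta * e / (2 * (L + 1)).
have d0 : 0 < d by rewrite divr_gt0 ?mulr_gt0//; lra.
have dE : (L + 1) * d = beta * (e / 2) by rewrite /d; field; rewrite gt_eqF//; lra.
have [l lP] := dist_limit.
have e2 : 0 < (e / 2) ^+ 2 by rewrite exprn_gt0// divr_gt0.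
(* The least drop of |x - z|^2 over [t, t + d] if |B(x) - Bz| >= e / 2 there. *)
have eta0 : 0 < 2 * beta * (e / 2) ^+ 2 * d by rewrite mulr_gt0// mulr_gt0// mulr_gt0.
have [T T1 TP] := lP _ eta0.
exists T => // t Tt; rewrite ltNge; apply/negP => et.
have t1 : 1 <= t by lra.
have [_ h1] := TP _ Tt.
have [h2 _] := TP (t + d) ltac:(lra).
have := @dist_drop t (t + d) ((e / 2) ^+ 2) ltac:(lra) ltac:(lra).
rewrite [t + d]addrC addrK (addrC d t) => h3.
suff : `|x (t + d) - z| ^+ 2 + 2 * beta * (e / 2) ^+ 2 * d <= `|x t - z| ^+ 2 by lra.
apply: h3 => r tr rt; rewrite ler_pXn2r ?nnegrE//; last lra.
have : `|B (x r) - B (x t)| <= e / 2.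
  rewrite -(ler_pM2l beta_gt0); apply: (le_trans (cocoercive_lipschitz _ _)).
  apply: (le_trans (LP _ _ t1 (ltW tr))).
  apply: (@le_trans _ _ ((L + 1) * d)); first by apply: ler_pM => //; lra.
  by rewrite dE.
have := ler_distD (B (x r)) (B (x t)) (B z); rewrite (distrC (B (x t)) (B (x r))); lra.
Qed.

(** * Phi along the orbit, and the energy *)

Context (Phi_lsc : lower_semicontinuous Phi).

Lemma subgradient_bound (a : R) : 0 < a -> exists2 M : R, 0 <= M &
  forall t, a <= t -> regular_time t -> `|- derive1 x t - B (x t)| <= M.
Proof.
move=> a0; have [L [L0 _ LP]] := orbit_lipschitz a0.
have [M MP] := orbit_bounded_pinfty.
have M0 : 0 <= M by apply: le_trans (MP 0 (lexx 0)).
exists (L + ((M + `|z|) / beta + `|B z|)) => [|t at_ [dx _]].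
  by rewrite !addr_ge0// divr_ge0 ?addr_ge0// ltW.
apply: (le_trans (ler_normB _ _)); rewrite normrN lerD ?LP//.
have := ler_normD (B (x t) - B z) (B z); rewrite subrK => /le_trans; apply.
rewrite lerD2r ler_pdivlMr// mulrC (le_trans (cocoercive_lipschitz _ _))//.
rewrite (le_trans (ler_normB _ _))// lerD2r MP//; lra.
Qed.

Lemma regular_time_near (t : R) (P : set R) : 0 <= t ->
  (\forall u \near t, P u) -> exists u, [/\ t < u, regular_time u & P u].
Proof.
move=> t0 /nbhs_ballP[r /= r0 rP].
have tr : t < t + r by rewrite ltrDl.
have [u [tu ur ru]] := regular_time_dense t0 tr.
exists u; split => //; apply: rP; rewrite /ball/= distrC gtr0_norm ?subr_gt0//.
by rewrite ltrBlDl.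
Qed.

Let phi (t : R) := fine (Phi (x t)).

Lemma Phi_orbit_ge (s t : R) : regular_time s ->
  ((phi s + dot (- derive1 x s - B (x s)) (x t - x s))%:E <= Phi (x t))%E.
Proof.
move=> [_ Fs]; have := Fs (x t).
by rewrite -(fineK (subdifferential_fin_num Fs)) -EFinD.
Qed.

(* Lower semicontinuity transfers the bound from the regular times, which are
   dense, to all times; in particular [Phi] is finite along the orbit. *)
Lemma Phi_orbit_le_regular (a M K s t : R) : 0 < a -> 0 <= M ->
  (forall t, a <= t -> regular_time t -> `|- derive1 x t - B (x t)| <= M) ->
  regular_time s -> a <= t -> (K%:E < Phi (x t))%E ->
  K <= phi s + M * `|x t - x s|.
Proof.
move=> a0 M0 MP rs at_ KPhi; have t0 : 0 < t by lra.
apply/ler_addgt0Pr => e e0; pose e' := e / (M + 1).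
have e'0 : 0 < e' by rewrite divr_gt0//; lra.
have Me' : M * e' <= e by rewrite /e' mulrA ler_pdivrMr; nra.
have [V Vxt VPhi] := Phi_lsc KPhi.
have ct : {for t, continuous x} := orbit_continuous t0.
have near_t : \forall u \near t, V (x u) /\ `|x t - x u| < e'.
  near=> u; split; first by near: u; exact: ct.
  by near: u; move/cvgr_dist_lt : ct; exact.
have [u [tu ru [Vu xu]]] := regular_time_near (ltW t0) near_t.
have := Phi_orbit_ge s ru.
have [_ Fs] := rs; rewrite -(fineK (subdifferential_fin_num Fs)) lee_fin -/(phi s).
have := VPhi _ Vu; have [_ Fu] := ru.
rewrite -(fineK (subdifferential_fin_num Fu)) lte_fin -/(phi u) => h1 h2.
have := dot_le_norm dot_norm (- derive1 x u - B (x u)) (- (x s - x u)).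
rewrite dotNr normrN => h3.
have h4 : `|- derive1 x u - B (x u)| * `|x s - x u| <= M * (`|x t - x s| + e').
  apply: ler_pM => //; first by apply: MP => //; lra.
  have := ler_distD (x t) (x s) (x u); rewrite (distrC (x s) (x t)); lra.
lra.
Unshelve. all: by end_near. Qed.

(** If Phi(x(t)) were +oo, every real would lie below it, against the bound by the value at a
    regular time s. *)
Lemma Phi_orbit_fin_num (t : R) : 0 < t -> Phi (x t) \is a fin_num.
Proof.
move=> t0; have [M M0 MP] := subgradient_bound t0.
have [s [ts rs _]] := regular_time_near (ltW t0) (filterT : \forall u \near t, setT u).
case: Phi_proper => Phi_gtNy _; rewrite fin_numElt Phi_gtNy/= ltNge.
apply/negP; rewrite leye_eq => /eqP Phi_oo.
have := @Phi_orbit_le_regular t M (phi s + M * `|x t - x s| + 1) s t t0 M0 MP rs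
  (lexx t).
by rewrite Phi_oo ltry => /(_ isT); lra.
Qed.

(** The bound is in terms of |x(t) - x(s)|, so absolute continuity passes from x to Phi o x. A
    regular time u just after s stands in for s. *)
Lemma Phi_orbit_lipschitz (a : R) : 0 < a -> exists2 M : R, 0 <= M &
  forall s t, a <= s -> a <= t -> `|phi t - phi s| <= M * `|x t - x s|.
Proof.
move=> a0; have [M M0 MP] := subgradient_bound a0; exists M => //.
suff half s t : a <= s -> a <= t -> phi t <= phi s + M * `|x t - x s|.
  move=> s t as_ at_; rewrite ler_norml; apply/andP; split.
    by have := half _ _ at_ as_; rewrite (distrC (x s)); lra.
  by have := half _ _ as_ at_; lra.
move=> as_ at_; apply/ler_addgt0Pr => e e0.
have s0 : 0 < s by lra.
have t0 : 0 < t by lra.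
pose e' := e / (2 * (M + 1)).
have e'0 : 0 < e' by rewrite divr_gt0//; lra.
have Me' : 2 * M * e' <= e.
  by rewrite /e' mulrA ler_pdivrMr; [nra|lra].
have near_s : \forall u \near s, `|x s - x u| < e'.
  by have /cvgr_dist_lt := orbit_continuous s0; exact.
have [u [su ru xu]] := regular_time_near (ltW s0) near_s.
have au : a <= u by lra.
have h1 : phi t <= phi u + M * `|x t - x u|.
  apply/ler_addgt0Pr => d d0; rewrite -lerBlDr.
  apply: (Phi_orbit_le_regular a0) => //.
  rewrite -(fineK (Phi_orbit_fin_num t0)) lte_fin -/(phi t); lra.
have := Phi_orbit_ge s ru.
rewrite -(fineK (Phi_orbit_fin_num s0)) lee_fin -/(phi s) => h2.
have h3 := dot_le_norm dot_norm (- derive1 x u - B (x u)) (- (x s - x u)).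
rewrite dotNr normrN in h3.
have h4 : `|- derive1 x u - B (x u)| * `|x s - x u| <= M * e'.
  by apply: ler_pM => //; [exact: MP|exact: ltW].
have h5 : M * `|x t - x u| <= M * (`|x t - x s| + e').
  by rewrite ler_wpM2l// (le_trans (ler_distD (x s) _ _))// lerD2l ltW.
lra.
Qed.

Definition energy (t : R) : R := phi t - fine (Phi z) + dot (B z) (x t - z) +
  (4 * beta)^-1 * `|x t - z| ^+ 2.

Lemma Phi_orbit_lower_bound (t : R) : 0 < t ->
  0 <= phi t - fine (Phi z) + dot (B z) (x t - z).
Proof.
move=> t0; have Fz := zeros_subdifferential.
have := Fz (x t); rewrite -(fineK (Phi_orbit_fin_num t0)).
rewrite -(fineK (subdifferential_fin_num Fz)) lee_fin -/(phi t) dotNl; lra.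
Qed.

Lemma energy_ge0 (t : R) : 0 < t -> 0 <= energy t.
Proof.
move=> t0; rewrite addr_ge0 ?Phi_orbit_lower_bound//.
by rewrite mulr_ge0 ?sqr_ge0// invr_ge0 mulr_ge0// ltW.
Qed.

(* The term |x - z|^2 / (4 beta) compensates the cross term <e, x'>, because its
   slope is at most - |e|^2 / 2. *)
Lemma energy_slope (t : R) : 0 < t -> regular_time t ->
  left_slope_le energy t (- (`|derive1 x t| ^+ 2 / 2)).
Proof.
move=> t0 rt; have [dx Ft] := rt.
pose w := - derive1 x t - B (x t) + B z.
have slope_Psi : left_slope_le (fun s => phi s - fine (Phi z) + dot (B z) (x s - z))
    t (dot w (derive1 x t)).
  apply: (left_slope_le_dot dot_norm (derivable_left_derivative dx)).
  near=> s; have s0 : 0 < s by near: s; exact: nbhs_left_gt.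
  have := Phi_orbit_ge s rt.
  rewrite -(fineK (Phi_orbit_fin_num s0)) lee_fin -/(phi s) /w.
  rewrite !(dotBr, dotDl); lra.
have b4 : 0 <= (4 * beta)^-1 by rewrite invr_ge0 mulr_ge0// ltW.
apply: left_slope_le_weak
  (left_slope_leD slope_Psi (left_slope_leZ b4 (dist_slope rt))).
have -> : (4 * beta)^-1 * - (2 * beta * `|B (x t) - B z| ^+ 2) =
    - (`|B (x t) - B z| ^+ 2 / 2) by field; rewrite gt_eqF.
(* What is left to prove, |x'|^2 / 2 + <e, x'> + |e|^2 / 2 >= 0, is half of this square. *)
have h := sqr_ge0 `|B (x t) - B z + derive1 x t|.
rewrite (sqr_normD dot_norm) dotBl in h.
rewrite /w dotDl !dotBl dotNl; rewrite -(dot_norm (derive1 x t)).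
lra.
Unshelve. all: by end_near. Qed.

Lemma energy_ac (a b : R) : 0 < a -> a <= b -> abs_continuous_on a b energy.
Proof.
move=> a0 ab; have [M M0 MP] := Phi_orbit_lipschitz a0.
have acx := orbit_ac a0 ab.
have b4 : 0 <= (4 * beta)^-1 by rewrite invr_ge0 mulr_ge0// ltW.
apply: (@abs_continuous_onD _ _ _
    (fun t => phi t - fine (Phi z) + dot (B z) (x t - z))
    (fun t => (4 * beta)^-1 * `|x t - z| ^+ 2)).
- apply: (abs_continuous_on_dominated (C := M + `|B z|) acx) => s t as_ st tb.
  have h1 := MP s t as_ (le_trans as_ st).
  have h2 := norm_dot_le dot_norm (B z) (x t - x s).
  have -> : phi t - fine (Phi z) + dot (B z) (x t - z) -
     (phi s - fine (Phi z) + dot (B z) (x s - z)) =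
     phi t - phi s + dot (B z) (x t - x s) by rewrite !dotBr; ring.
  by rewrite (le_trans (ler_normD _ _))// mulrDl lerD.
- apply: (abs_continuous_on_dominated (C := (4 * beta)^-1) (dist_ac a0 ab)).
  by move=> s t _ _ _; rewrite -mulrBr normrM ger0_norm.
- by move=> s t _ _ _; rewrite /energy opprD addrACA ler_normD.
Qed.

Lemma energy_drop (s t k : R) : 0 < s -> s <= t ->
  (forall r, s < r -> r <= t -> regular_time r -> k <= `|derive1 x r| ^+ 2 / 2) ->
  energy t + k * (t - s) <= energy s.
Proof.
move=> s0 st kP.
suff : energy t - energy s <= - k * (t - s) by lra.
apply: left_slope_increment => //; first exact: energy_ac.
apply: filterS ae_regular_time; first exact: (ae_filter_ringOfSetsType mu).
move=> r rr sr rt; have r0 : 0 < r by lra.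
apply: left_slope_le_weak (energy_slope r0 (rr r0)).
by rewrite lerN2 kP//; exact: rr.
Qed.

Lemma energy_nonincreasing (s t : R) : 0 < s -> s <= t -> energy t <= energy s.
Proof.
move=> s0 st; have := @energy_drop s t 0 s0 st.
rewrite mul0r addr0; apply => r _ _ _.
by rewrite divr_ge0// sqr_ge0.
Qed.

Lemma speed_cvg0 (e : R) : 0 < e -> exists2 T, 1 <= T &
  forall t, T <= t -> regular_time t -> `|derive1 x t| < e.
Proof.
move=> e0.
have [l lP] : exists l : R, forall e, 0 < e -> exists2 T, 1 <= T &
    forall t, T <= t -> l <= energy t /\ energy t < l + e.
  apply: (nonincreasing_pinfty_limit (m := 0)) => [s t s1 st|t t1].
    by apply: energy_nonincreasing => //; lra.
  by apply: energy_ge0; lra.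
have eta0 : 0 < e ^+ 2 / 2 by rewrite divr_gt0// exprn_gt0.
have [T T1 TP] := lP _ eta0.
(* The + 1 places the window [t - 1, t] after T; a speed of at least e at t is at least e at all
   regular times of the window. *)
exists (T + 1) => [|t Tt [dx _]]; first lra.
rewrite ltNge; apply/negP => et.
have Tt1 : T <= t - 1 by lra.
have [_ h1] := TP _ Tt1.
have Tt' : T <= t by lra.
have [h2 _] := TP _ Tt'.
have t10 : 0 < t - 1 by lra.
have t1t : t - 1 <= t by lra.
have := @energy_drop (t - 1) t (e ^+ 2 / 2) t10 t1t.
have -> : t - (t - 1) = 1 by lra.
rewrite mulr1 => h3.
suff : energy t + e ^+ 2 / 2 <= energy (t - 1) by lra.
apply: h3 => r r1 rt [dxr _].
have r0 : 0 < r by lra.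
rewrite ler_pM2r// ler_pXn2r ?nnegrE ?(ltW e0)//.
exact: le_trans et (speed_nonincreasing r0 rt dxr dx).
Qed.

(** At regular times the subgradient - x' - Bx tends strongly to - Bz while x is bounded, so - Bz
    satisfies the subgradient inequality up to eta. A nearby regular time serves for the other t. *)
Lemma Phi_orbit_asymptotically_minimal (v : H) (eta : R) : Phi v \is a fin_num ->
  0 < eta -> exists2 T, 1 <= T & forall t, T <= t ->
    phi t + dot (- B z) (v - x t) - eta <= fine (Phi v).
Proof.
move=> Fv eta0; have [M MP] := orbit_bounded_pinfty.
have [L L0 LP] := Phi_orbit_lipschitz ltr01.
have M0 : 0 <= M by apply: le_trans (MP 0 (lexx 0)).
pose K := `|v| + M; have K0 : 0 <= K by rewrite addr_ge0.
(* d will bound |x'| and |e|, and K bounds |v - x|: replacing the subgradient by - Bz costs at most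
   eta / 2. *)
pose d := eta / (4 * (K + 1)).
have d0 : 0 < d by rewrite divr_gt0//; lra.
have Kd : K * (d + d) <= eta / 2.
  have -> : eta / 2 = (K + 1) * (d + d) by rewrite /d; field; rewrite gt_eqF//; lra.
  by rewrite ler_wpM2r//; lra.
(* Moving from the regular time u to t costs at most (L + |Bz|) r <= eta / 2. *)
pose r := eta / (2 * (L + `|B z| + 1)).
have LB : 0 <= L + `|B z| by rewrite addr_ge0.
have r0 : 0 < r by rewrite divr_gt0//; lra.
have Lr : (L + `|B z|) * r <= eta / 2.
  have -> : eta / 2 = (L + `|B z| + 1) * r by rewrite /r; field; rewrite gt_eqF//; lra.
  by rewrite ler_wpM2r//; lra.
have [T1 T11 T1P] := speed_cvg0 d0.
have [T2 T21 T2P] := B_orbit_cvg d0.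
exists (Num.max T1 T2) => [|t]; first by rewrite le_max T11.
rewrite ge_max => /andP[T1t T2t].
have t0 : 0 < t by lra.
have near_t : \forall u \near t, `|x t - x u| < r.
  by have /cvgr_dist_lt := orbit_continuous t0; exact.
have [u [tu ru xu]] := regular_time_near (ltW t0) near_t.
have T1u : T1 <= u by lra.
have T2u : T2 <= u by lra.
have u1 : 1 <= u by lra.
have t1 : 1 <= t by lra.
have h1 := LP u t u1 t1.
have h2 := ler_norm (phi t - phi u).
have [_ Fu] := ru; have := Fu v.
rewrite -(fineK (subdifferential_fin_num Fu)) -(fineK Fv) lee_fin -/(phi u) => h3.
have h4 := dot_le_norm dot_norm (derive1 x u + (B (x u) - B z)) (v - x u).
have h5 : `|derive1 x u + (B (x u) - B z)| * `|v - x u| <= K * (d + d).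
  rewrite mulrC; apply: ler_pM => //.
    by rewrite (le_trans (ler_normB _ _))// lerD2l MP//; lra.
  by rewrite (le_trans (ler_normD _ _))// lerD// ltW ?T1P ?T2P.
have h6 := dot_le_norm dot_norm (B z) (x t - x u).
have h7 : (L + `|B z|) * `|x t - x u| <= (L + `|B z|) * r.
  by rewrite ler_wpM2l// ltW.
move: h3 h4 h6; rewrite !(dotBl, dotDl, dotNl, dotBr); lra.
Qed.

(** * Weak cluster points, and integrability of the squared speed *)

Context (Phi_convex : convex_efunction Phi).

Lemma sublevel_closed (k : R) : closed [set u | (Phi u <= k%:E)%E].
Proof.
have -> : [set u | (Phi u <= k%:E)%E] = ~` [set u | (k%:E < Phi u)%E].
  by apply/seteqP; split => u /=; rewrite leNgt => /negP.
by rewrite closedC; exact: (lower_semicontinuousP Phi).1.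
Qed.

Lemma sublevel_convex (k : R) : convex_subset [set u | (Phi u <= k%:E)%E].
Proof.
move=> u v t t01 /= uk vk; have /andP[t0 t1] := t01.
apply: (le_trans (Phi_convex u v t01)).
have -> : k%:E = (t%:E * k%:E + (1 - t)%:E * k%:E)%E.
  by rewrite -!EFinM -EFinD; congr EFin; ring.
by apply: leeD; apply: lee_wpmul2l => //; rewrite lee_fin// subr_ge0.
Qed.

(** Sublevel sets of Phi are closed and convex, hence stable under weak limits, so the asymptotic
    subgradient inequality passes to w. That Bw = Bz follows from cocoercivity between x(t) and w:
    <B(x(t)) - Bw, x(t) - w> tends to 0 because B(x(t)) -> Bz strongly, whence beta |Bz - Bw|^2 <=
    0. *)
Lemma weak_cluster_zero (F : set_system R) (w : H) : ProperFilter F ->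
  pinfty_nbhs R `<=` F -> (forall y, dot (x t) y @[t --> F] --> dot w y) ->
  zeros dot Phi B w.
Proof.
move=> FF oF xw.
have F_ge T : F [set t | T <= t].
  by apply: oF; apply: nbhs_pinfty_ge; exact: num_real.
have sub_w : subdifferential dot Phi w (- B z).
  move=> v; have [Fv|] := boolP (Phi v \is a fin_num); last first.
    rewrite fin_numElt; case: Phi_proper => Phi_gtNy _.
    by rewrite Phi_gtNy/= -leNgt leye_eq => /eqP ->; rewrite leey.
  rewrite -leeBrDr// -(fineK Fv) -EFinB; apply/lee_addgt0Pr => e e0.
  have e2 : 0 < e / 2 by lra.
  rewrite -EFinD; have [T T1 TP] := Phi_orbit_asymptotically_minimal Fv e2.
  apply: (weak_closed_convex dot_norm FF xw (@sublevel_closed _) (@sublevel_convex _)).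
  have /cvgr_dist_lt/(_ _ e2) near_w := xw (B z).
  apply: filterS2 near_w (F_ge T) => t /= tw Tt.
  have t0 : 0 < t by lra.
  rewrite -(fineK (Phi_orbit_fin_num t0)) lee_fin -/(phi t).
  have := TP t Tt; have := ler_norm (dot w (B z) - dot (x t) (B z)).
  by rewrite !(dotBr, dotNl) (dotC _ _ w) (dotC _ _ (x t)); lra.
exists (- B z) => //; apply/eqP; rewrite addrC subr_eq0 eq_sym; apply/eqP.
have cB : B (x t) @[t --> F] --> B z.
  apply/cvgrPdist_lt => e e0; have [T _ TP] := B_orbit_cvg e0.
  by apply: filterS (F_ge T) => t Tt; rewrite distrC; exact: TP.
have [M MP] := orbit_bounded_pinfty.
have c1 : dot (B (x t) - B z) (x t - w) @[t --> F] --> (0 : R).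
  apply/cvgrPdist_lt => e e0; have d0 : 0 < e / (`|M| + `|w| + 1).
    by rewrite divr_gt0// ltr_wpDl// addr_ge0.
  have /cvgr_dist_lt/(_ _ d0) near_B := cB.
  apply: filterS2 near_B (F_ge 0) => t Bt t0.
  rewrite sub0r normrN; apply: (le_lt_trans (norm_dot_le dot_norm _ _)).
  apply: (@le_lt_trans _ _ (`|B (x t) - B z| * (`|M| + `|w| + 1))).
    rewrite ler_wpM2l// (le_trans (ler_normB _ _))//.
    by have := MP t t0; have := ler_norm M; lra.
  by rewrite -ltr_pdivlMr ?ltr_wpDl ?addr_ge0// distrC.
have c2 : dot (B z - B w) (x t - w) @[t --> F] --> (0 : R).
  rewrite -(subrr (dot w (B z - B w))).
  under eq_fun do rewrite dotC dotBl.
  by apply: cvgB; [exact: xw|exact: cvg_cst].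
have c3 : beta * `|B (x t) - B w| ^+ 2 @[t --> F] --> beta * `|B z - B w| ^+ 2.
  apply: cvgM; first exact: cvg_cst.
  have cn : `|B (x t) - B w| @[t --> F] --> `|B z - B w|.
    by apply: cvg_norm; apply: cvgB => //; exact: cvg_cst.
  by rewrite expr2; under eq_fun do rewrite expr2; exact: cvgM.
have c4 : dot (B (x t) - B z) (x t - w) + dot (B z - B w) (x t - w) -
    beta * `|B (x t) - B w| ^+ 2 @[t --> F] --> 0 + 0 - beta * `|B z - B w| ^+ 2.
  by apply: cvgB c3; exact: cvgD.
have : 0 <= 0 + 0 - beta * `|B z - B w| ^+ 2.
  apply: (cvgr_to_ge c4); apply: nearW => t.
  have := B_cocoercive (x t) w; rewrite !(dotBl, dotBr); lra.
rewrite !add0r oppr_ge0 pmulr_rle0// => h.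
have : `|B z - B w| ^+ 2 = 0 by apply/eqP; rewrite eq_le h sqr_ge0.
by move/eqP; rewrite sqrf_eq0 normr_eq0 subr_eq0 => /eqP.
Qed.

(** 2 E decreases at a rate of at least |x'|^2 and E >= 0, so each interval contributes at most 2 C.
    The exhausting intervals stay away from a, because the speed is bounded only away from 0 and a =
    0 is allowed. *)
Lemma finite_energy_of_bound (a C : R) : 0 <= a ->
  (forall s, a < s -> energy s <= C) -> finite_energy a x.
Proof.
move=> a0 EC.
have mI (c d : itv_bound R) : measurable ([set` Interval c d] : set R).
  exact: measurable_itv.
have mspeed (D : set R) : measurable D -> D `<=` `]0, +oo[%classic ->
    measurable_fun D (fun t : R => `|derive1 x t| ^+ 2).
  move=> mD D0; apply: measurable_funX; apply: measurable_funS D0 _ => //.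
  exact: (measurable_speed orbit_continuous).
have m0 : measurable_fun (`]a, +oo[%classic : set R) (fun t : R => `|derive1 x t| ^+ 2).
  by apply: mspeed => // t /=; rewrite !in_itv/= !andbT; exact: le_lt_trans.
have local_bound s b : a < s -> s <= b ->
    (\int[mu]_(t in `]s, b]) (`|derive1 x t| ^+ 2)%:E <= (2 * C)%:E)%E.
  move=> as_ sb; have s0 : 0 < s by lra.
  have [L [L0 _ LP]] := orbit_lipschitz s0.
  have b0 : 0 < b by lra.
  apply: (@le_trans _ _ (2 * energy s - 2 * energy b)%:E); last first.
    by rewrite lee_fin; have := EC s as_; have := energy_ge0 b0; lra.
  (* The term with [point] covers the times without derivative, where [derive1] takes that default
     value. *)
  apply: (@integral_le_decrement _ (fun t => 2 * energy t) _ s b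
    ((L + `|point : H|) ^+ 2)) => //.
  - by apply: mspeed => // t /=; rewrite !in_itv/= andbT => /andP[st _]; lra.
  - move=> t st _; rewrite sqr_ge0/= ler_pXn2r ?nnegrE ?addr_ge0//.
    have [dt|ndt] := pselect (derivable x t 1).
      by rewrite (le_trans (LP t (ltW st) dt))// lerDl.
    rewrite /derive1 dvgP ?lerDr// => ct; apply: ndt.
    by rewrite /derivable; under eq_fun do rewrite /= [_ *: 1]mulr1.
  - apply: (abs_continuous_on_dominated (C := 2) (energy_ac s0 sb)) => u v _ _ _.
    by rewrite -mulrBr normrM ger0_norm.
  - apply: filterS ae_regular_time; first exact: (ae_filter_ringOfSetsType mu).
    move=> t rt st tb; have t0 : 0 < t by lra.
    have := left_slope_leZ (ler0n R 2) (energy_slope t0 (rt t0)).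
    by apply: left_slope_le_weak; lra.
apply/integrableP; split; first by apply/measurable_EFinP.
apply: (@le_lt_trans _ _ (2 * C)%:E); last exact: ltry.
under eq_integral do rewrite gee0_abs ?lee_fin ?sqr_ge0//.
pose I (n : nat) : set R := `]a + n.+1%:R^-1, a + n.+1%:R]%classic.
have n1 n : n.+1%:R^-1 <= 1 :> R by rewrite invf_le1// ler1n.
apply: (@ge0_integral_exhaustion _ _ R (@lebesgue_measure R) _ _ I (2 * C)%:E) => //.
- exact/measurable_EFinP.
- move=> n m nm; rewrite subsetEset => t; rewrite /I/= !in_itv/= => /andP[h1 h2].
  have h3 : m.+1%:R^-1 <= n.+1%:R^-1 :> R by rewrite lef_pV2 ?posrE// ler_nat.
  have h4 : n.+1%:R <= m.+1%:R :> R by rewrite ler_nat.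
  by rewrite (le_lt_trans _ h1) ?lerD2l// (le_trans h2)// lerD2l.
- by move=> n; exact: measurable_itv.
- apply/seteqP; split => t.
    move=> [n _]; rewrite /I/= !in_itv/= andbT => /andP[h _]; apply: lt_trans h.
    by rewrite ltrDl invr_gt0.
  rewrite /= in_itv/= andbT => at_.
  pose n := maxn (Num.truncn (t - a)^-1) (Num.truncn (t - a)).
  have ta : 0 < t - a by rewrite subr_gt0.
  exists n => //; rewrite /I/= in_itv/= -ltrBrDl -lerBlDl; apply/andP; split.
    rewrite invf_plt ?posrE//; apply: lt_le_trans (truncnS_gt _) _.
    by rewrite ler_nat ltnS leq_maxl.
  apply: le_trans (ltW (truncnS_gt _)) _.
  by rewrite ler_nat ltnS leq_maxr.
- move=> n; apply: local_bound; first by rewrite ltrDl invr_gt0.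
  by rewrite lerD2l (le_trans (n1 n))// ler1n.
Qed.

Lemma finite_energy_pos (a : R) : 0 < a -> finite_energy a x.
Proof.
move=> a0; apply: (@finite_energy_of_bound a (energy a)); first exact: ltW.
by move=> s as_; apply: energy_nonincreasing => //; exact: ltW.
Qed.

(* With x' = - p - B x and p in the subdifferential at x(s), the derivative of
   |x(s) - x(0)|^2 is at most 2 (Phi(x(0)) - Phi(x(s))) up to a constant; since
   the energy is nonincreasing, a large value of it at t would make
   |x(t) - x(0)|^2 negative. *)
Lemma energy_bounded_domain : effective_domain Phi (x 0) ->
  exists C, forall t, 0 < t -> energy t <= C.
Proof.
move=> Phi0; have F0 : Phi (x 0) \is a fin_num.
  by case: Phi_proper => Phi_gtNy _; rewrite fin_numElt Phi_gtNy.
have [M MP] := orbit_bounded_pinfty.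
have M0 : 0 <= M by apply: le_trans (MP 0 (lexx 0)).
have b4 : 0 <= (4 * beta)^-1 by rewrite invr_ge0 mulr_ge0// ltW.
pose C1 := `|fine (Phi z)| + `|B z| * (M + `|z|) + (4 * beta)^-1 * (M + `|z|) ^+ 2.
pose MB := (M + `|z|) / beta + `|B z|.
have xz t : 0 <= t -> `|x t - z| <= M + `|z|.
  by move=> t0; rewrite (le_trans (ler_normB _ _))// lerD2r MP.
have BM t : 0 <= t -> `|B (x t)| <= MB.
  move=> t0; have := ler_normD (B (x t) - B z) (B z); rewrite subrK => /le_trans.
  apply; rewrite lerD2r ler_pdivlMr// mulrC.
  by rewrite (le_trans (cocoercive_lipschitz _ _))// xz.
have energy_le t : 0 < t -> energy t <= phi t + C1.
  move=> t0; have h1 := ler_norm (- fine (Phi z)); rewrite normrN in h1.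
  have h2 := dot_le_norm dot_norm (B z) (x t - z).
  have h3 : `|B z| * `|x t - z| <= `|B z| * (M + `|z|) by rewrite ler_wpM2l// xz// ltW.
  have h4 : (4 * beta)^-1 * `|x t - z| ^+ 2 <= (4 * beta)^-1 * (M + `|z|) ^+ 2.
    by rewrite ler_wpM2l// ler_pXn2r ?nnegrE ?addr_ge0// xz// ltW.
  by rewrite /energy /C1; lra.
exists (fine (Phi (x 0)) + C1 + MB * (2 * M)) => t t0.
rewrite leNgt; apply/negP => large.
pose k := energy t - (fine (Phi (x 0)) + C1 + MB * (2 * M)).
have k0 : 0 < k by rewrite subr_gt0.
have decr s : 0 < s -> s <= t ->
    `|x t - x 0| ^+ 2 - `|x s - x 0| ^+ 2 <= - (2 * k) * (t - s).
  move=> s0 st; apply: (@left_slope_increment _ (fun r => `|x r - x 0| ^+ 2)) => //.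
    apply: (@abs_continuous_on_sqr_dist _ _ x (x 0) s t M); last exact: orbit_ac.
    by move=> r sr _; apply: MP; lra.
  apply: filterS ae_regular_time; first exact: (ae_filter_ringOfSetsType mu).
  move=> r rr sr rt; have r0 : 0 < r by lra.
  have {}rr := rr r0; have [dr Fr] := rr.
  have := left_slope_sqr_dist dot_norm (x 0) (derivable_left_derivative dr).
  apply: left_slope_le_weak.
  have := Fr (x 0); rewrite -(fineK (subdifferential_fin_num Fr)) -(fineK F0) lee_fin.
  rewrite -/(phi r) => h1.
  have h2 := energy_nonincreasing r0 rt; have h3 := energy_le r r0.
  have h4 := dot_le_norm dot_norm (B (x r)) (x 0 - x r).
  have h5 : `|B (x r)| * `|x 0 - x r| <= MB * (2 * M).
    apply: ler_pM => //; first by apply: BM; lra.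
    apply: (le_trans (ler_normB _ _)).
    by have := MP 0 (lexx 0); have := MP r (ltW r0); lra.
  rewrite dotC; move: h1 h4; rewrite /k !(dotBl, dotNl, dotBr); lra.
have kt : 0 < k * t by rewrite mulr_gt0.
have [cx _ _] := x_orbit.
have [_ /cvgr_dist_lt c0] := (continuous_within_itvcyP 0 x).1 cx.
(* For s <= t / 2 the drop from s to t is at least k t, more than |x(s) - x(0)|^2; the minimum with
   1 makes the square at most the norm. *)
have d0 : 0 < Num.min 1 (k * t) by rewrite lt_min ltr01.
have near0 := c0 _ d0.
near (0 : R)^'+ => s.
have s0 : 0 < s by near: s; exact: nbhs_right_gt.
have st : s <= t / 2 by near: s; apply: nbhs_right_le; lra.
have : `|x 0 - x s| < Num.min 1 (k * t) by near: s; exact: near0.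
rewrite lt_min distrC => /andP[h1 h2].
have st' : s <= t by lra.
have := decr s s0 st'; have := sqr_ge0 `|x t - x 0|.
have h3 : `|x s - x 0| ^+ 2 <= `|x s - x 0|.
  by rewrite expr2 ler_piMr// ltW.
have h4 : k * t <= 2 * k * (t - s) by nra.
lra.
Unshelve. all: by end_near. Qed.

Lemma finite_energy0 : effective_domain Phi (x 0) -> finite_energy 0 x.
Proof.
by move=> /energy_bounded_domain[C CP]; exact: (finite_energy_of_bound (lexx 0) CP).
Qed.

End orbit.

(* An orbit may start anywhere in the closure of dom Phi. If x(0) is not in
   dom Phi, the energy is finite on every ]a, +oo[ with a > 0, but it can be
   infinite on ]0, +oo[: take H = R, B = 0, x(0) = 0 and Phi(u) = u + 1/u for
   u > 0, Phi(u) = +oo otherwise; then x(t) ~ (3t)^(1/3) as t -> 0. *)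
Theorem theorem3p1 (R : realType) (H : completeNormedModType R)
    (dot : {dot H for @idfun R}) (dot_norm : induces_norm dot)
    (Phi : H -> \bar R) (Phi_proper : proper_function Phi)
    (Phi_convex : convex_efunction Phi) (Phi_lsc : lower_semicontinuous Phi)
    (B : H -> H) (beta : R) (beta_gt0 : 0 < beta)
    (B_monotone : monotone_operator dot B)
    (B_cocoercive : cocoercive dot beta B)
    (S_nonempty : zeros dot Phi B !=set0)
    (x : R -> H) (x_orbit : strong_solution dot Phi B x) :
  [/\ (effective_domain Phi (x 0) -> finite_energy 0 x) /\
        (forall a : R, 0 < a -> finite_energy a x),
      (exists2 z : H, zeros dot Phi B z & weakly_cvg_pinfty dot x z) &
      (forall z w : H, zeros dot Phi B z -> zeros dot Phi B w -> B z = B w) /\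
        (forall z : H, zeros dot Phi B z -> B (x t) @[t --> +oo] --> B z)].
Proof.
have [z0 Sz0] := S_nonempty.
split; first split.
- exact: (finite_energy0 dot_norm Phi_proper B_monotone x_orbit beta_gt0
    B_cocoercive Sz0 Phi_lsc).
- exact: (finite_energy_pos dot_norm Phi_proper B_monotone x_orbit beta_gt0
    B_cocoercive Sz0 Phi_lsc).
- have [M MP] := orbit_bounded_pinfty dot_norm Phi_proper x_orbit beta_gt0
    B_cocoercive Sz0.
  apply: (opial dot_norm MP) => [z Sz|F w FF oF xw].
    exact: (dist_cvg dot_norm Phi_proper x_orbit beta_gt0 B_cocoercive Sz).
  exact: (weak_cluster_zero dot_norm Phi_proper B_monotone x_orbit beta_gt0
    B_cocoercive Sz0 Phi_lsc Phi_convex FF oF xw).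
split => [z w Sz Sw|z Sz].
  (* Monotonicity of the subdifferential gives <Bz - Bw, z - w> <= 0, and by cocoercivity beta |Bz -
     Bw|^2 is a lower bound of it. *)
  have := subdifferential_monotone Phi_proper (zeros_subdifferential Sz)
    (zeros_subdifferential Sw).
  have := B_cocoercive z w; rewrite !(dotBl, dotNl) => h1 h2.
  have : beta * `|B z - B w| ^+ 2 <= 0 by lra.
  rewrite pmulr_rle0// => h; have : `|B z - B w| ^+ 2 = 0.
    by apply/eqP; rewrite eq_le h sqr_ge0.
  by move/eqP; rewrite sqrf_eq0 normr_eq0 subr_eq0 => /eqP.
apply/cvgrPdist_lt => e e0.
have [T _ TP] := B_orbit_cvg dot_norm Phi_proper B_monotone x_orbit beta_gt0
  B_cocoercive Sz e0.
near=> t; rewrite distrC; apply: TP.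
by near: t; apply: nbhs_pinfty_ge; exact: num_real.
Unshelve. all: by end_near. Qed.
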